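(* Let $\Omega_\infty$ be the (coefficientwise) limit of $\Omega_q[q]/q$ when $q$ goes to $\infty$. Then $$\Omega_\infty=\sum_T\frac{(-1)^{\#T-1}}{\mathrm{aut}(T)}\,T,$$ where the sum runs over all (isomorphism classes of) rooted trees $T$, $\#T$ is the number of vertices of $T$, and $\mathrm{aut}(T)$ is the cardinality of the automorphism group of the rooted tree $T$.
   Context: For a field $K$ ($K=\mathbb{Q}$ or $\mathbb{Q}(q)$, $q$ an indeterminate), $\mathrm{PL}=\bigoplus_{n\ge1}\mathrm{PL}_n$ is the $K$-vector space with basis the isomorphism classes of (unlabeled, non-planar) rooted trees, graded by the number $\#T$ of vertices. The pre-Lie product is $T\curvearrowleft T'=\sum_{v}$ (tree obtained from $T\sqcup T'$ by adding an edge from the root of $T'$ to $v$), sum over vertices $v$ of $T$, the root being that of $T$. Denote by $\bullet$ the one-vertex tree; $\mathrm{PL}$ is the free (right) pre-Lie algebra on $\bullet$, and a Lie algebra for $[x,y]=x\curvearrowleft y-y\curvearrowleft x$. Let $\widehat{\mathrm{PL}}=\prod_{n\ge1}\mathrm{PL}_n$ and let $\widehat U(\mathrm{PL})$ be the (degree-)completed universal enveloping algebra, with associative product $\star$. The product $\curvearrowleft$ is a right action of the Lie algebra, so extends to a right action of $\widehat U(\mathrm{PL})$ on $\widehat{\mathrm{PL}}$: $x\curvearrowleft(u\star v)=(x\curvearrowleft u)\curvearrowleft v$. Exponentials are computed in $\widehat U(\mathrm{PL})$. $\Omega\in\widehat{\mathrm{PL}}_{\mathbb{Q}}$ is the unique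 solution of $\bullet\curvearrowleft\left(\frac{\Omega}{\exp(\Omega)-1}\right)=\Omega$, where $\frac{x}{e^x-1}$ is expanded as a power series. For $A=\sum_{n\ge 1}A_n$ (homogeneous components), $A[q]=\sum_n q^nA_n$. $\Omega_q\in\widehat{\mathrm{PL}}_{\mathbb{Q}(q)}$ is the unique solution of $$\Omega_q[q]\curvearrowleft(\exp(\Omega)-1)+\Omega_q[q]-\Omega_q=\bullet\curvearrowleft\Omega_q+(q-1)\bullet .$$ The coefficient of each rooted tree $T$ in $\Omega_q$ has a formal Laurent expansion in powers of $q^{-1}$ starting at exponent at least $\#T-1$, so that the limit $\Omega_\infty$ exists. *)

(* Defs.v *)
From HB Require Import structures.
From mathcomp Require Import all_boot all_order all_algebra perm ring_quotient.
From mathcomp Require Import boolp classical_sets functions cardinality fsbigop.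

Set Implicit Arguments.
Unset Strict Implicit.
Unset Printing Implicit Defensive.

Import Order.TTheory GRing.Theory Num.Theory.

Local Open Scope ring_scope.
Local Open Scope quotient_scope.

(* A rooted tree with vertex set 'I_n is encoded by its parent map, with the  *)
(* convention that the root is its own parent.                                *)
Definition is_rooted_tree (p : {n : nat & {ffun 'I_n -> 'I_n}}) : bool :=
  [exists r, (tagged p r == r) && [forall v, fconnect (tagged p) v r]].

Definition ltree := {p : {n : nat & {ffun 'I_n -> 'I_n}} | is_rooted_tree p}.

HB.instance Definition _ := Choice.on ltree.

Definition nverts (t : ltree) : nat := tag (val t).

Notation vertex t := 'I_(nverts t).

Definition parent (t : ltree) : {ffun vertex t -> vertex t} := tagged (val t).

(* An isomorphism automatically maps the root to the root, the root being the *)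
(* only fixed point of the parent map.                                        *)
Definition tree_iso (t t' : ltree) : bool :=
  `[< exists2 f : vertex t -> vertex t',
        bijective f & forall v, f (parent t v) = parent t' (f v) >].

Lemma tree_iso_refl : reflexive tree_iso.
Proof. by move=> t; apply/asboolP; exists id => //; exists id. Qed.

Lemma tree_iso_sym : symmetric tree_iso.
Proof.
suff H t t' : tree_iso t t' -> tree_iso t' t.
  by move=> t t'; apply/idP/idP; apply: H.
move=> /asboolP[f [g fK gK] fp]; apply/asboolP; exists g; first by exists f.
by move=> v; rewrite -{1}(gK v) -fp fK.
Qed.

Lemma tree_iso_trans : transitive tree_iso.
Proof.
move=> b a c /asboolP[f bf fp] /asboolP[g bg gp]; apply/asboolP.
exists (g \o f); first exact: bij_comp.
by move=> v /=; rewrite fp gp.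
Qed.

Canonical tree_iso_equiv :=
  EquivRel tree_iso tree_iso_refl tree_iso_sym tree_iso_trans.

Definition rtree := {eq_quot tree_iso}.

HB.instance Definition _ := Choice.on rtree.

Definition treesize (T : rtree) : nat := nverts (repr T).

(* The number of automorphisms; it does not depend on the representative.     *)
Definition aut (T : rtree) : nat :=
  #|[pred s : {perm vertex (repr T)} |
      [forall v, s (parent (repr T) v) == parent (repr T) (s v)]]|.

Lemma iso_pi t t' : (\pi_rtree t == \pi_rtree t') = tree_iso t t'.
Proof. by rewrite eqmodE. Qed.

Lemma iso_repr t : tree_iso t (repr (\pi_rtree t)).
Proof. by rewrite -iso_pi reprK. Qed.

Lemma iso_nverts t t' : tree_iso t t' -> nverts t = nverts t'.
Proof.
by move=> /asboolP[f bf _]; move: (bij_eq_card bf); rewrite !card_ord.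
Qed.

Lemma treesize_pi t : treesize (\pi_rtree t) = nverts t.
Proof. by rewrite /treesize -(iso_nverts (iso_repr t)). Qed.

Lemma rootP (t : ltree) :
  exists r, parent t r = r /\ forall v, exists k, iter k (parent t) v = r.
Proof.
case: t => p Hp; rewrite /parent /=; case/existsP: (Hp) => r /andP[/eqP pr /forallP H].
exists r; split => // v; exists (findex (tagged p) v r).
exact: iter_findex.
Qed.

Lemma is_rooted_treeI (p : {n : nat & {ffun 'I_n -> 'I_n}}) r :
  tagged p r = r -> (forall v, exists k, iter k (tagged p) v = r) ->
  is_rooted_tree p.
Proof.
move=> pr H; apply/existsP; exists r; rewrite pr eqxx /=; apply/forallP => v.
by have [k <-] := H v; apply: fconnect_iter.
Qed.

Lemma parent_fix_uniq (t : ltree) r s : parent t r = r -> parent t s = s -> r = s.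
Proof.
have [x [_ H]] := rootP t => rr ss.
have F y : parent t y = y -> y = x.
  move=> yy; have [k <-] := H y; elim: k => //= k <-; by rewrite yy.
by rewrite (F r rr) (F s ss).
Qed.

Lemma dot_sub :
  is_rooted_tree (existT (fun n => {ffun 'I_n -> 'I_n}) 1%N [ffun i => i]).
Proof.
apply: (@is_rooted_treeI
  (existT (fun n => {ffun 'I_n -> 'I_n}) 1%N [ffun i => i]) ord0) => [|v] /=.
  by rewrite ffunE.
by exists 0%N; rewrite /= [v]ord1.
Qed.

Definition dot_ltree : ltree := exist is_rooted_tree _ dot_sub.

Definition dot : rtree := \pi dot_ltree.

Section Graft.
Variables (t : ltree) (v : vertex t) (t' : ltree).

(* The root of t' becomes a child of v.                                       *)
Definition graft_map : {ffun 'I_(nverts t + nverts t') -> 'I_(nverts t + nverts t')} :=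
  [ffun i => match fintype.split i with
             | inl a => lshift _ (parent t a)
             | inr b => if parent t' b == b then lshift _ v
                        else rshift _ (parent t' b)
             end].

Lemma graft_mapl a : graft_map (lshift _ a) = lshift _ (parent t a).
Proof. by rewrite ffunE; case: (split_ordP (lshift _ a)) => b /eqP;
  rewrite ?(inj_eq (@lshift_inj _ _)) ?eq_lrshift // => /eqP ->. Qed.

Lemma graft_mapr b : graft_map (rshift _ b) =
  if parent t' b == b then lshift _ v else rshift _ (parent t' b).
Proof. by rewrite ffunE; case: (split_ordP (rshift _ b)) => a /eqP;
  rewrite ?(inj_eq (@rshift_inj _ _)) ?eq_rlshift // => /eqP ->. Qed.

Lemma graft_subproof : 
  is_rooted_tree (existT (fun n => {ffun 'I_n -> 'I_n}) _ graft_map).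
Proof.
have [r [rr Hr]] := rootP t; have [r' [rr' Hr']] := rootP t'.
have itl k a : iter k graft_map (lshift _ a) = lshift _ (iter k (parent t) a).
  by elim: k => //= k ->; rewrite graft_mapl.
apply: (@is_rooted_treeI (existT (fun n => {ffun 'I_n -> 'I_n}) _ graft_map)
  (lshift _ r)) => /=; first by rewrite graft_mapl rr.
have Hl a : exists k, iter k graft_map (lshift _ a) = lshift _ r.
  by have [k Hk] := Hr a; exists k; rewrite itl Hk.
move=> i; case: (split_ordP i) => [a|b] ->; first exact: Hl.
have [k Hk] := Hr' b; elim: k b Hk => [|k IH] b Hk.
  have [j Hj] := Hl v; exists j.+1; rewrite iterSr graft_mapr.
  by move: Hk => /= ->; rewrite rr' eqxx.
case: (parent t' b =P b) => [Hb|/eqP Hb].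
  have [j Hj] := Hl v; exists j.+1; rewrite iterSr graft_mapr.
  by rewrite Hb eqxx.
have [|j Hj] := IH (parent t' b); first by rewrite -iterSr.
by exists j.+1; rewrite iterSr graft_mapr (negPf Hb).
Qed.

Definition graft : ltree := exist is_rooted_tree _ graft_subproof.
End Graft.

(* The coefficient of S in the pre-Lie product of the trees T and T'.         *)
Definition graft_count (T T' S : rtree) : nat :=
  #|[pred v : vertex (repr T) | \pi_rtree (graft v (repr T')) == S]|.


Lemma split_lshift m n (a : 'I_m) : fintype.split (lshift n a) = inl a.
Proof. exact: (unsplitK (inl a)). Qed.

Lemma split_rshift m n (b : 'I_n) : fintype.split (rshift m b) = inr b.
Proof. exact: (unsplitK (inr b)). Qed.

Lemma graft_parentl (t : ltree) v (t' : ltree) (a : vertex t) :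
  parent (@graft t v t') (lshift _ a) = lshift _ (parent t a).
Proof. exact: graft_mapl. Qed.

Lemma graft_parentr (t : ltree) v (t' : ltree) (b : vertex t') :
  parent (@graft t v t') (rshift _ b) =
  if parent t' b == b then lshift _ v else rshift _ (parent t' b).
Proof. exact: graft_mapr. Qed.

Lemma graft_iso (t t' s s' : ltree) (f : vertex t -> vertex t') v :
  bijective f -> (forall v, f (parent t v) = parent t' (f v)) ->
  tree_iso s s' -> tree_iso (@graft t v s) (@graft t' (f v) s').
Proof.
move=> [g fK gK] fp /asboolP[h [k hK kK] hp]; apply/asboolP.
exists (fun i => match fintype.split i with
                 | inl a => lshift _ (f a) | inr b => rshift _ (h b) end).
  exists (fun i => match fintype.split i with
                 | inl a => lshift _ (g a) | inr b => rshift _ (k b) end) => i.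
    by case: (split_ordP i) => j ->; rewrite ?split_lshift ?split_rshift ?fK ?hK.
  by case: (split_ordP i) => j ->; rewrite ?split_lshift ?split_rshift ?gK ?kK.
move=> i; case: (split_ordP i) => j ->.
  by rewrite graft_parentl ?split_lshift graft_parentl fp.
rewrite graft_parentr ?split_rshift graft_parentr -hp (can_eq hK).
by case: eqP => _; rewrite ?split_lshift ?split_rshift.
Qed.

Lemma graft_graftr (t : ltree) v (s : ltree) w (r : ltree) :
  tree_iso (@graft (@graft t v s) (rshift _ w) r) (@graft t v (@graft s w r)).
Proof.
apply/asboolP.
exists (fun i : vertex (@graft (@graft t v s) (rshift _ w) r) =>
  match fintype.split i with
  | inl j => match fintype.split j with
             | inl a => lshift _ a | inr b => rshift _ (lshift _ b) end
  | inr c => rshift _ (rshift _ c) end : vertex (@graft t v (@graft s w r))).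
  exists (fun i : vertex (@graft t v (@graft s w r)) =>
  match fintype.split i with
  | inl a => lshift _ (lshift _ a)
  | inr j => match fintype.split j with
             | inl b => lshift _ (rshift _ b) | inr c => rshift _ c end
  end : vertex (@graft (@graft t v s) (rshift _ w) r)) => i.
    case: (split_ordP i) => j ->; rewrite ?split_lshift ?split_rshift //.
    by case: (split_ordP j) => k ->; rewrite ?(split_lshift, split_rshift).
  case: (split_ordP i) => j ->; rewrite ?(split_lshift, split_rshift) //.
  by case: (split_ordP j) => k ->; rewrite ?(split_lshift, split_rshift).
move=> i; case: (split_ordP i) => j ->.
  rewrite graft_parentl ?split_lshift.
  case: (split_ordP j) => k ->.
    by rewrite !graft_parentl ?split_lshift ?graft_parentl.
  rewrite graft_parentr ?split_rshift graft_parentr graft_parentl eq_lshift.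
  by case: eqP => _; rewrite ?split_lshift ?split_rshift.
rewrite graft_parentr ?split_rshift graft_parentr graft_parentr.
case: (parent r j =P j) => [|/eqP Hj].
  by rewrite !(split_lshift, split_rshift) eq_lrshift.
by rewrite !split_rshift eq_rshift (negPf Hj).
Qed.

Lemma graft_graftl (t : ltree) v w (s r : ltree) :
  tree_iso (@graft (@graft t v s) (lshift _ w) r)
           (@graft (@graft t w r) (lshift _ v) s).
Proof.
pose F (s r : ltree) v w (i : vertex (@graft (@graft t v s) (lshift _ w) r)) :=
  match fintype.split i with
  | inl j => match fintype.split j with
             | inl a => lshift _ (lshift _ a) | inr b => rshift _ b end
  | inr c => lshift _ (rshift _ c)
  end : vertex (@graft (@graft t w r) (lshift _ v) s).
have FK s' r' v' w' : cancel (F s' r' v' w') (F r' s' w' v').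
  rewrite /F => i; case: (split_ordP i) => j -> /=; last by rewrite !(split_lshift, split_rshift).
  by case: (split_ordP j) => k -> /=; rewrite !(split_lshift, split_rshift).
apply/asboolP; exists (F s r v w); first by exists (F r s w v); apply: FK.
rewrite /F => i; case: (split_ordP i) => j ->.
  rewrite graft_parentl split_lshift; case: (split_ordP j) => k ->.
    by rewrite !graft_parentl split_lshift.
  rewrite !graft_parentr; case: (parent s k =P k) => _.
    by rewrite split_lshift.
  by rewrite split_rshift.
rewrite graft_parentr graft_parentl graft_parentr.
case: (parent r j =P j) => _; first by rewrite !split_lshift.
by rewrite split_rshift.
Qed.


Lemma graft_count_neq0 T T' S :
  graft_count T T' S != 0%N -> treesize S = (treesize T + treesize T')%N.
Proof.
rewrite -lt0n => /card_gt0P[v]; rewrite inE => /eqP <-.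
by rewrite treesize_pi.
Qed.

Lemma treesize_gt0 T : (0 < treesize T)%N.
Proof. by rewrite /treesize; have [[i ri] _] := rootP (repr T); apply: leq_ltn_trans ri. Qed.

Definition trees_le (N : nat) : seq rtree :=
  undup [seq \pi_rtree t | t <- pmap insub
    (flatten [seq [seq existT (fun n => {ffun 'I_n -> 'I_n}) n f
                  | f <- enum {: {ffun 'I_n -> 'I_n}}] | n <- iota 0 N.+1])].

Lemma trees_le_uniq N : uniq (trees_le N).
Proof. exact: undup_uniq. Qed.

Lemma mem_trees_le N T : (treesize T <= N)%N -> T \in trees_le N.
Proof.
move=> HT; rewrite mem_undup -(reprK T); apply/mapP; exists (repr T) => //.
rewrite mem_pmap; apply/mapP; exists (val (repr T)); last by rewrite valK.
apply/flatten_mapP; exists (treesize T); first by rewrite mem_iota.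
rewrite /treesize /nverts; case: (val (repr T)) => n f /=.
by apply/mapP; exists f => //; rewrite mem_enum.
Qed.


Lemma graft_countE t t' S : graft_count (\pi_rtree t) (\pi_rtree t') S =
  (\sum_(v < nverts t) (\pi_rtree (graft v t') == S))%N.
Proof.
rewrite /graft_count -sum1_card big_mkcond /=.
have /asboolP[f bf fp] := iso_repr t.
rewrite [LHS](reindex f) /=; last exact: onW_bij.
apply: eq_bigr => v _; rewrite inE; have /eqP -> :
   \pi_rtree (graft (f v) (repr (\pi_rtree t'))) == \pi_rtree (graft v t').
  by rewrite eq_sym iso_pi; apply: graft_iso => //; apply: iso_repr.
by case: eqP.
Qed.

Lemma graft_count_suml N t t' (G : rtree -> nat) :
  (forall R, (N < treesize R)%N -> G R = 0%N) ->
  (\sum_(R <- trees_le N) graft_count (\pi_rtree t) (\pi_rtree t') R * G R =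
   \sum_(v < nverts t) G (\pi_rtree (graft v t')))%N.
Proof.
move=> HG; under eq_bigr do rewrite graft_countE big_distrl /=.
rewrite exchange_big; apply: eq_bigr => v _ /=; set R0 := \pi_rtree _.
case HR: (R0 \in trees_le N).
  rewrite (bigD1_seq R0) ?trees_le_uniq //= eqxx mul1n big1 ?addn0 // => R.
  by rewrite eq_sym => /negPf ->.
rewrite HG ?big1_seq // => [R /andP[_ HR']|]; last first.
  by rewrite ltnNge; apply/negP => /mem_trees_le; rewrite HR.
by case: eqP => // E; rewrite E HR' in HR.
Qed.

Lemma graft_count_big T R S N :
  (treesize S <= N)%N -> (N < treesize T)%N || (N < treesize R)%N -> graft_count T R S = 0%N.
Proof.
move=> HS H; apply/eqP; apply: contraTT H => /graft_count_neq0 E.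
by rewrite negb_or -!leqNgt; apply/andP; split; apply: leq_trans HS; rewrite E ?leq_addr ?leq_addl.
Qed.

Lemma graft_count_prelie N T T1 T2 S : (treesize S <= N)%N ->
  (\sum_(R <- trees_le N) graft_count T T1 R * graft_count R T2 S
   + \sum_(R <- trees_le N) graft_count T2 T1 R * graft_count T R S =
   \sum_(R <- trees_le N) graft_count T T2 R * graft_count R T1 S
   + \sum_(R <- trees_le N) graft_count T1 T2 R * graft_count T R S)%N.
Proof.
move=> HS; rewrite -(reprK T) -(reprK T1) -(reprK T2).
move: (repr T) (repr T1) (repr T2) => t t1 t2.
have HL a b : (\sum_(R <- trees_le N)
    graft_count (\pi_rtree t) (\pi_rtree a) R * graft_count R (\pi_rtree b) S =
  \sum_(v < nverts t) \sum_(w < nverts t)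
     (\pi_rtree (graft (lshift _ w : vertex (graft v a)) b) == S) +
  \sum_(R <- trees_le N)
    graft_count (\pi_rtree a) (\pi_rtree b) R * graft_count (\pi_rtree t) R S)%N.
  rewrite !graft_count_suml => [|R HR|R HR].
  - under eq_bigr do rewrite graft_countE big_split_ord /=.
    rewrite big_split /=; congr (_ + _)%N.
    under [RHS]eq_bigr do rewrite graft_countE.
    rewrite [RHS]exchange_big; apply: eq_bigr => v _; apply: eq_bigr => w _ /=.
    suff /eqP -> : \pi_rtree (graft (rshift (nverts t) w : vertex (graft v a)) b)
       == \pi_rtree (graft v (graft w b)) by [].
    by rewrite iso_pi; apply: graft_graftr.
  - by apply: (graft_count_big HS); rewrite HR orbT.
  - by apply: (graft_count_big HS); rewrite HR.
rewrite !HL -!addnA; congr (_ + _)%N; last exact: addnC.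
rewrite exchange_big; apply: eq_bigr => v _; apply: eq_bigr => w _.
suff /eqP -> : \pi_rtree (graft (lshift _ v : vertex (graft w t1)) t2)
   == \pi_rtree (graft (lshift _ w : vertex (graft v t2)) t1) by [].
by rewrite iso_pi; apply: graft_graftl.
Qed.

Definition word := seq rtree.

Definition wdeg (w : word) : nat := (\sum_(T <- w) treesize T)%N.

Lemma wdeg_cons T w : wdeg (T :: w) = (treesize T + wdeg w)%N.
Proof. exact: big_cons. Qed.

Lemma wdeg_cat w w' : wdeg (w ++ w') = (wdeg w + wdeg w')%N.
Proof. exact: big_cat. Qed.

Lemma size_wdeg w : (size w <= wdeg w)%N.
Proof.
elim: w => //= T w IH; rewrite wdeg_cons -add1n.
by apply: leq_add => //; apply: treesize_gt0.
Qed.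

Fixpoint words_size_le (N k : nat) : seq word :=
  if k is k'.+1 then
    [::] :: [seq T :: w | T <- trees_le N, w <- words_size_le N k']
  else [:: [::]].

Definition words_le (N : nat) : seq word :=
  undup [seq w <- words_size_le N N | (wdeg w <= N)%N].

Lemma words_le_uniq N : uniq (words_le N).
Proof. exact: undup_uniq. Qed.

Lemma mem_words_le N w : (w \in words_le N) = (wdeg w <= N)%N.
Proof.
rewrite mem_undup mem_filter; case: leqP => //= Hw.
have: (size w <= N)%N := leq_trans (size_wdeg w) Hw.
move: {1 3}N => k; elim: w k Hw => [|T w IH] [|k] Hw Hs //=; rewrite inE //=.
apply/allpairsP; exists (T, w) => /=; split => //.
  by apply: mem_trees_le; move: Hw; rewrite wdeg_cons => /(leq_trans _); apply; apply: leq_addr.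
by apply: IH => //; move: Hw; rewrite wdeg_cons => /(leq_trans _); apply; apply: leq_addl.
Qed.

Lemma fsum_seq (I : choiceType) (V : nmodType) (s : seq I) (F : I -> V) :
  uniq s -> (forall i, i \notin s -> F i = 0) ->
  \sum_(i \in [set: I]) F i = \sum_(i <- s) F i.
Proof.
move=> us Fs; rewrite (fsbig_seq _ _ us); apply/esym/fsbig_widen => //.
by move=> i /= [_ /negP]; apply: Fs.
Qed.

Section Algebra.
Variable K : fieldType.

(* Since there are finitely many trees of each size, the degree completion of *)
(* PL is the space of all families of scalars indexed by the rooted trees.    *)
Definition PLhat := rtree -> K.

HB.instance Definition _ := GRing.Lmodule.copy PLhat (rtree -> K^o).

Definition tree_elt (T : rtree) : PLhat := fun S => (S == T)%:R.

(* The sum has finite support, as graft_count T T' S != 0 implies             *)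
(* treesize S = treesize T + treesize T'.                                     *)
Definition prelie (x y : PLhat) : PLhat := fun S =>
  \sum_(p \in [set: rtree * rtree])
    x p.1 * y p.2 * (graft_count p.1 p.2 S)%:R.

Lemma prelieE N (x y : PLhat) S : (treesize S <= N)%N ->
  prelie x y S = \sum_(T <- trees_le N) \sum_(T' <- trees_le N)
    x T * y T' * (graft_count T T' S)%:R.
Proof.
move=> HS; pose h (T T' : rtree) := (T, T').
rewrite -(big_allpairs_dep (h := h) (F := fun p : rtree * rtree =>
  x p.1 * y p.2 * (graft_count p.1 p.2 S)%:R)) /=.
rewrite /prelie (fsum_seq (s := [seq (T, T') | T <- trees_le N, T' <- trees_le N])) //.
  by apply: allpairs_uniq => //; rewrite ?trees_le_uniq // => -[? ?] [? ?].
move=> [T T'] /= Hn; case: (graft_count T T' S =P 0%N) => [->|/eqP /graft_count_neq0 E].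
  by rewrite mulr0.
case/negP: Hn; apply/allpairsP; exists (T, T'); split => //=; apply: mem_trees_le;
  by apply: leq_trans HS; rewrite E ?leq_addr ?leq_addl.
Qed.

Lemma prelie_tree N (x : PLhat) T S : (treesize S <= N)%N ->
  prelie x (tree_elt T) S = \sum_(R <- trees_le N) x R * (graft_count R T S)%:R.
Proof.
move=> HS; rewrite (prelieE _ _ HS); apply: eq_bigr => R _.
case HT: (T \in trees_le N); last first.
  rewrite big1_seq => [|T' /andP[_ HT']]; last first.
    rewrite /tree_elt; case: eqP => [E|_]; last by rewrite mulr0 mul0r.
    by rewrite E HT in HT'.
  case: (graft_count R T S =P 0%N) => [->|/eqP /graft_count_neq0 E]; first by rewrite mulr0.
  by rewrite mem_trees_le // in HT; apply: leq_trans HS; rewrite E leq_addl.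
rewrite (bigD1_seq T) ?trees_le_uniq //= big1 => [|T' /negPf HT'].
  by rewrite /tree_elt eqxx mulr1 addr0.
by rewrite /tree_elt HT' mulr0 mul0r.
Qed.

(* The completed tensor algebra of PL: families of scalars indexed by words   *)
(* in the rooted trees, with the concatenation product.                       *)
Definition tens := word -> K.

HB.instance Definition _ := GRing.Lmodule.copy tens (word -> K^o).

Definition tens_word (w : word) : tens := fun w' => (w' == w)%:R.

Definition tens_mul (f g : tens) : tens := fun w =>
  \sum_(k < (size w).+1) f (take k w) * g (drop k w).

Definition tens_shift (f : tens) (T : rtree) : tens := fun w => f (T :: w).

Lemma tens_mul_nil f g : tens_mul f g [::] = f [::] * g [::].
Proof. by rewrite /tens_mul big_ord1. Qed.

Lemma tens_mul_cons f g T w : tens_mul f g (T :: w) =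
  f [::] * g (T :: w) + tens_mul (tens_shift f T) g w.
Proof. by rewrite /tens_mul big_ord_recl /=. Qed.

Lemma tensP (f g : tens) : (forall w, f w = g w) -> f = g.
Proof. by move=> H; apply/funext. Qed.

Lemma tensD (f g : tens) w : (f + g) w = f w + g w. Proof. by []. Qed.
Lemma tensB (f g : tens) w : (f - g) w = f w - g w. Proof. by []. Qed.
Lemma tensZ a (f : tens) w : (a *: f) w = a * f w. Proof. by []. Qed.
Lemma tens0 w : (0 : tens) w = 0. Proof. by []. Qed.
Lemma tens_sum I r (P : pred I) (F : I -> tens) w :
  (\sum_(i <- r | P i) F i) w = \sum_(i <- r | P i) F i w.
Proof. by elim/big_rec2: _ => //= i y x _ <-. Qed.

Lemma tens_mulDl : left_distributive tens_mul +%R.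
Proof.
move=> f g h; apply: tensP => w; rewrite tensD /tens_mul -big_split /=.
by apply: eq_bigr => i _; rewrite tensD mulrDl.
Qed.

Lemma tens_mulDr : right_distributive tens_mul +%R.
Proof.
move=> f g h; apply: tensP => w; rewrite tensD /tens_mul -big_split /=.
by apply: eq_bigr => i _; rewrite tensD mulrDr.
Qed.

Lemma tens_mulZl a f g : tens_mul (a *: f) g = a *: tens_mul f g.
Proof.
apply: tensP => w; rewrite tensZ /tens_mul mulr_sumr.
by apply: eq_bigr => i _; rewrite tensZ mulrA.
Qed.

Lemma tens_mulZr a f g : tens_mul f (a *: g) = a *: tens_mul f g.
Proof.
apply: tensP => w; rewrite tensZ /tens_mul mulr_sumr.
by apply: eq_bigr => i _; rewrite tensZ mulrCA.
Qed.

Lemma tens_mulA : associative tens_mul.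
Proof.
move=> f g h; apply: tensP => w; elim: w f => [|T w IH] f.
  by rewrite !tens_mul_nil mulrA.
rewrite !tens_mul_cons tens_mul_nil IH.
have -> : tens_shift (tens_mul f g) T =
   f [::] *: tens_shift g T + tens_mul (tens_shift f T) g.
  by apply: tensP => w'; rewrite /tens_shift tens_mul_cons.
by rewrite tens_mulDl tens_mulZl tensD tensZ addrA mulrDr !mulrA.
Qed.

Lemma tens_mul0l g : tens_mul 0 g = 0.
Proof. by rewrite -[in LHS](scale0r (0 : tens)) tens_mulZl scale0r. Qed.

Lemma tens_mul1l : left_id (tens_word [::]) tens_mul.
Proof.
move=> f; apply: tensP => -[|T w]; first by rewrite tens_mul_nil /tens_word eqxx mul1r.
rewrite tens_mul_cons /tens_word eqxx mul1r.
have -> : tens_shift (fun w' => (w' == [::])%:R) T = 0 by apply: tensP => w'.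
by rewrite tens_mul0l addr0.
Qed.

Lemma tens_mul1r : right_id (tens_word [::]) tens_mul.
Proof.
move=> f; apply: tensP => w; elim: w f => [|T w IH] f.
  by rewrite tens_mul_nil /tens_word eqxx mulr1.
by rewrite tens_mul_cons IH /tens_word mulr0 add0r.
Qed.

HB.instance Definition _ := GRing.Zmodule_isPzRing.Build tens
  tens_mulA tens_mul1l tens_mul1r tens_mulDl tens_mulDr.

Lemma tensM (f g : tens) w :
  (f * g) w = \sum_(k < (size w).+1) f (take k w) * g (drop k w).
Proof. by []. Qed.

Lemma tens_scalerAl a (f g : tens) : a *: (f * g) = (a *: f) * g.
Proof. by rewrite [RHS]tens_mulZl. Qed.

Lemma tens_scalerAr a (f g : tens) : a *: (f * g) = f * (a *: g).
Proof. by rewrite [RHS]tens_mulZr. Qed.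

Lemma tens_shift_word T w T' :
  tens_shift (tens_word (T :: w)) T' = ((T' == T)%:R : K) *: tens_word w.
Proof.
apply: tensP => v; rewrite /tens_shift tensZ /tens_word eqseq_cons.
by case: (T' == T); rewrite ?mul1r ?mul0r.
Qed.

Lemma tens_word_cat w w' : tens_word (w ++ w') = tens_word w * tens_word w'.
Proof.
elim: w => [|T w IH]; first by rewrite mul1r.
apply: tensP => -[|T' v]; first by rewrite [RHS]tens_mul_nil /tens_word /= mul0r.
rewrite [RHS]tens_mul_cons tens_shift_word tens_mulZl tensZ.
rewrite -[tens_mul _ _]/(tens_word w * tens_word w') -IH.
rewrite /tens_word /= mul0r add0r eqseq_cons.
by case: (T' == T); rewrite ?mul1r ?mul0r.
Qed.

(* The embedding of completed PL as the words of length 1.                    *)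
Definition tens_elt (x : PLhat) : tens := fun w => if w is [:: T] then x T else 0.

Definition lie (x y : PLhat) : PLhat := prelie x y - prelie y x.

Definition envel_gen (p : (word * word) * (rtree * rtree)) : tens :=
  let: ((w, w'), (T, T')) := p in
  tens_word w *
  (tens_word [:: T; T'] - tens_word [:: T'; T]
   - tens_elt (lie (tree_elt T) (tree_elt T'))) *
  tens_word w'.

Definition envel_span (f : tens) : Prop :=
  exists s : seq (K * ((word * word) * (rtree * rtree))),
    f = \sum_(c <- s) c.1 *: envel_gen c.2.

Definition hcomp (n : nat) (f : tens) : tens :=
  fun w => if wdeg w == n then f w else 0.

(* The closure, in the completed tensor algebra, of the ideal that defines    *)
(* the enveloping algebra.                                                    *)
Definition envel_ideal : {pred tens} :=
  [pred f | `[< forall n, envel_span (hcomp n f) >]].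

Lemma envel_span0 : envel_span 0.
Proof. by exists [::]; rewrite big_nil. Qed.

Lemma envel_spanD f g : envel_span f -> envel_span g -> envel_span (f + g).
Proof. by move=> [s ->] [s' ->]; exists (s ++ s'); rewrite big_cat. Qed.

Lemma envel_spanZ a f : envel_span f -> envel_span (a *: f).
Proof.
move=> [s ->]; exists [seq (a * c.1, c.2) | c <- s].
by rewrite big_map scaler_sumr; apply: eq_bigr => c _; rewrite scalerA.
Qed.

Lemma envel_span_sum I r (P : pred I) (F : I -> tens) :
  (forall i, P i -> envel_span (F i)) -> envel_span (\sum_(i <- r | P i) F i).
Proof.
move=> H; elim/big_ind: _ => //; [exact: envel_span0 | exact: envel_spanD].
Qed.

Lemma envel_span_Ml w f : envel_span f -> envel_span (tens_word w * f).
Proof.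
move=> [s ->]; rewrite mulr_sumr; apply: envel_span_sum => -[a [[v v'] [T T']]] _ /=.
exists [:: (a, ((w ++ v, v'), (T, T')))]; rewrite big_seq1 /=.
by rewrite -tens_scalerAr tens_word_cat !mulrA.
Qed.

Lemma envel_span_Mr w f : envel_span f -> envel_span (f * tens_word w).
Proof.
move=> [s ->]; rewrite mulr_suml; apply: envel_span_sum => -[a [[v v'] [T T']]] _ /=.
exists [:: (a, ((v, v' ++ w), (T, T')))]; rewrite big_seq1 /=.
by rewrite -tens_scalerAl tens_word_cat !mulrA.
Qed.

Lemma hcompE n f w : hcomp n f w = (wdeg w == n)%:R * f w.
Proof. by rewrite /hcomp; case: eqP; rewrite ?mul1r ?mul0r. Qed.

Lemma hcompD n f g : hcomp n (f + g) = hcomp n f + hcomp n g.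
Proof. by apply: tensP => w; rewrite tensD !hcompE mulrDr. Qed.

Lemma hcompZ n a f : hcomp n (a *: f) = a *: hcomp n f.
Proof. by apply: tensP => w; rewrite tensZ !hcompE tensZ mulrCA. Qed.

Lemma hcompN n f : hcomp n (- f) = - hcomp n f.
Proof. by rewrite -!scaleN1r hcompZ. Qed.

Lemma hcompB n f g : hcomp n (f - g) = hcomp n f - hcomp n g.
Proof. by rewrite hcompD hcompN. Qed.

Lemma hcomp0 n : hcomp n 0 = 0.
Proof. by rewrite -[in LHS](scale0r (0 : tens)) hcompZ scale0r. Qed.

Lemma hcomp_words n f :
  hcomp n f = \sum_(w <- words_le n) hcomp n f w *: tens_word w.
Proof.
apply: tensP => v; rewrite tens_sum.
case Hv: (v \in words_le n).
  rewrite (bigD1_seq v) ?words_le_uniq //= big1 => [|w /negPf Hw].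
    by rewrite tensZ /tens_word eqxx mulr1 addr0.
  by rewrite tensZ /tens_word eq_sym Hw mulr0.
rewrite big1_seq => [|w /andP[_ Hw]].
  move: Hv; rewrite mem_words_le /hcomp; case: eqP => // ->.
  by rewrite leqnn.
rewrite tensZ /tens_word; case: eqP => [E|_]; last by rewrite mulr0.
by rewrite E Hw in Hv.
Qed.

Lemma hcompM n f g :
  hcomp n (f * g) = \sum_(i < n.+1) hcomp i f * hcomp (n - i) g.
Proof.
apply: tensP => w; rewrite tens_sum hcompE tensM mulr_sumr.
under [RHS]eq_bigr do rewrite tensM.
rewrite [RHS]exchange_big; apply: eq_bigr => k _ /=.
have Ew : wdeg w = (wdeg (take k w) + wdeg (drop k w))%N.
  by rewrite -wdeg_cat cat_take_drop.
case: eqP => Hn; last first.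
  rewrite mul0r big1 // => i _; rewrite !hcompE.
  case: eqP => [E1|_]; last by rewrite !mul0r.
  case: eqP => [E2|_]; last by rewrite mul0r mulr0.
  by case: Hn; rewrite Ew E1 E2 subnKC // -ltnS.
have Hi : (wdeg (take k w) < n.+1)%N by rewrite ltnS -Hn Ew leq_addr.
rewrite (bigD1 (Ordinal Hi)) //= big1 ?addr0 => [|i Hni].
  by rewrite !hcompE eqxx -Hn Ew addKn eqxx !mul1r.
rewrite hcompE; case: eqP => [E|_]; last by rewrite !mul0r.
by case/eqP: Hni; apply: val_inj.
Qed.

Lemma envel_idealP f :
  reflect (forall n, envel_span (hcomp n f)) (f \in envel_ideal).
Proof. by apply: (iffP idP) => [/asboolP|H]; last apply/asboolP. Qed.

Lemma envel_ideal_zmod : zmod_closed envel_ideal.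
Proof.
split=> [|f g /envel_idealP Hf /envel_idealP Hg]; apply/envel_idealP => n.
  by rewrite hcomp0; apply: envel_span0.
rewrite hcompB -scaleN1r; apply: envel_spanD; first exact: Hf.
exact: envel_spanZ.
Qed.

HB.instance Definition _ := GRing.isZmodClosed.Build tens envel_ideal
  envel_ideal_zmod.

Lemma envel_idealMl f g : g \in envel_ideal -> f * g \in envel_ideal.
Proof.
move=> /envel_idealP Hg; apply/envel_idealP => n; rewrite hcompM.
apply: envel_span_sum => i _; rewrite hcomp_words mulr_suml.
apply: envel_span_sum => w _; rewrite -tens_scalerAl.
exact/envel_spanZ/envel_span_Ml.
Qed.

Lemma envel_idealMr f g : f \in envel_ideal -> f * g \in envel_ideal.
Proof.
move=> /envel_idealP Hf; apply/envel_idealP => n; rewrite hcompM.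
apply: envel_span_sum => i _; rewrite [hcomp (n - i) g]hcomp_words mulr_sumr.
apply: envel_span_sum => w _; rewrite -tens_scalerAr.
exact/envel_spanZ/envel_span_Mr.
Qed.

(* The degree completion of the enveloping algebra of PL, whose product is    *)
(* denoted by * below.                                                        *)
Definition Uhat := Quotient.quot envel_ideal.

HB.instance Definition _ := GRing.Zmodule.on Uhat.

Definition Uproj (f : tens) : Uhat := \pi_Uhat f.
Definition Urepr (u : Uhat) : tens := repr u.

Lemma UreprK u : Uproj (Urepr u) = u.
Proof. exact: reprK. Qed.

Lemma Uproj_eq f g : (Uproj f = Uproj g) <-> (f - g \in envel_ideal).
Proof. by rewrite Quotient.idealrBE; split => [H|/eqP]; first exact/eqP. Qed.

Lemma Urepr_proj f : Urepr (Uproj f) - f \in envel_ideal.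
Proof. by apply/Uproj_eq; rewrite UreprK. Qed.

Lemma UprojB f g : Uproj (f - g) = Uproj f - Uproj g.
Proof. exact: raddfB. Qed.

Lemma UprojD f g : Uproj (f + g) = Uproj f + Uproj g.
Proof. exact: raddfD. Qed.

Definition Umul (u v : Uhat) : Uhat := Uproj (Urepr u * Urepr v).

Lemma UprojM f g : Uproj (f * g) = Umul (Uproj f) (Uproj g).
Proof.
apply/esym/Uproj_eq; set f' := Urepr _; set g' := Urepr _.
rewrite -[f' * g'](subrK (f' * g)) -addrA -mulrBr -mulrBl rpredD //.
  exact/envel_idealMl/Urepr_proj.
exact/envel_idealMr/Urepr_proj.
Qed.

Lemma UmulA : associative Umul.
Proof.
by move=> u v w; rewrite -(UreprK u) -(UreprK v) -(UreprK w) -!UprojM mulrA.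
Qed.

Lemma Umul1l : left_id (Uproj 1) Umul.
Proof. by move=> u; rewrite -(UreprK u) -UprojM mul1r. Qed.

Lemma Umul1r : right_id (Uproj 1) Umul.
Proof. by move=> u; rewrite -(UreprK u) -UprojM mulr1. Qed.

Lemma UmulDl : left_distributive Umul +%R.
Proof.
move=> u v w; rewrite -(UreprK u) -(UreprK v) -(UreprK w).
by rewrite -UprojD -!UprojM mulrDl UprojD.
Qed.

Lemma UmulDr : right_distributive Umul +%R.
Proof.
move=> u v w; rewrite -(UreprK u) -(UreprK v) -(UreprK w).
by rewrite -UprojD -!UprojM mulrDr UprojD.
Qed.

HB.instance Definition _ := GRing.Zmodule_isPzRing.Build Uhat
  UmulA Umul1l Umul1r UmulDl UmulDr.

Definition word_act (x : PLhat) (w : word) : PLhat :=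
  foldl (fun y T => prelie y (tree_elt T)) x w.

(* The sum has finite support, as word_act x w S vanishes as soon as          *)
(* treesize S <= wdeg w.                                                      *)
Definition tens_act (x : PLhat) (f : tens) : PLhat := fun S =>
  \sum_(w \in [set: word]) f w * word_act x w S.

Lemma PLhatP (x y : PLhat) : (forall T, x T = y T) -> x = y.
Proof. by move=> H; apply/funext. Qed.

Lemma word_act_eq0 m (x : PLhat) w S :
  (forall T, (treesize T <= m)%N -> x T = 0) -> (treesize S <= m + wdeg w)%N ->
  word_act x w S = 0.
Proof.
elim: w m x => [|T w IH] m x Hx.
  by rewrite /wdeg big_nil addn0; apply: Hx.
rewrite wdeg_cons addnA; apply: IH => R HR.
rewrite (prelie_tree _ _ (leqnn _)) big1_seq // => R' _.
case: (graft_count R' T R =P 0%N) => [->|/eqP /graft_count_neq0 E]; first by rewrite mulr0.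
by rewrite Hx ?mul0r //; move: HR; rewrite E leq_add2r.
Qed.

Lemma word_act_small (x : PLhat) w S : (treesize S <= wdeg w)%N -> word_act x w S = 0.
Proof.
move=> H; apply: (@word_act_eq0 0) => // T; rewrite leqn0 => /eqP E.
by have := treesize_gt0 T; rewrite E.
Qed.

Lemma tens_actE N x f S : (treesize S <= N)%N ->
  tens_act x f S = \sum_(w <- words_le N) f w * word_act x w S.
Proof.
move=> HS; rewrite /tens_act (fsum_seq (words_le_uniq N)) // => w.
rewrite mem_words_le -ltnNge => Hw; rewrite word_act_small ?mulr0 //.
exact: leq_trans HS (ltnW Hw).
Qed.

Lemma word_act_lin N I (s : seq I) (a : I -> K) (y : I -> PLhat) (y0 : PLhat) w :
  (forall T, (treesize T <= N)%N -> y0 T = \sum_(i <- s) a i * y i T) ->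
  forall S, (treesize S <= N)%N ->
  word_act y0 w S = \sum_(i <- s) a i * word_act (y i) w S.
Proof.
elim: w y0 y => [|T w IH] y0 y Hy S HS /=; first exact: Hy.
apply: IH => // R HR; rewrite (prelie_tree _ _ (leqnn _)).
under [RHS]eq_bigr do rewrite (prelie_tree _ _ (leqnn _)) mulr_sumr.
rewrite exchange_big; apply: eq_bigr => R' _ /=.
case: (graft_count R' T R =P 0%N) => [->|/eqP /graft_count_neq0 E].
  by rewrite mulr0 big1 // => i _; rewrite !mulr0.
rewrite Hy ?mulr_suml; first by apply: eq_bigr => i _; rewrite mulrA.
by apply: leq_trans HR; rewrite E leq_addr.
Qed.

Lemma word_act_cat x w w' : word_act x (w ++ w') = word_act (word_act x w) w'.
Proof. exact: foldl_cat. Qed.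

Lemma words_le_split N (G : word -> word -> K) :
  (forall w w', (N < wdeg (w ++ w'))%N -> G w w' = 0) ->
  \sum_(w <- words_le N) \sum_(k < (size w).+1) G (take k w) (drop k w) =
  \sum_(w <- words_le N) \sum_(w' <- words_le N) G w w'.
Proof.
move=> HG.
pose P1 := [seq p : word * word <- [seq (w, w') | w <- words_le N, w' <- words_le N]
             | (wdeg (p.1 ++ p.2) <= N)%N].
pose P2 := [seq (take k w, drop k w) | w <- words_le N, k <- iota 0 (size w).+1].
have P12 : perm_eq P2 P1.
  apply: uniq_perm.
  - apply: allpairs_uniq_dep => [|w _|]; [exact: words_le_uniq | exact: iota_uniq |].
    move=> [w k] [w' k'] /allpairsPdep[w1 [k1 [_ Hk1 [-> ->]]]].
    move=> /allpairsPdep[w2 [k2 [_ Hk2 [-> ->]]]] [E1 E2].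
    have Ew : w1 = w2 by rewrite -(cat_take_drop k1 w1) E1 E2 cat_take_drop.
    move: E1; rewrite Ew => /(congr1 size); move: Hk1 Hk2; rewrite !mem_iota !add0n /= Ew !ltnS.
    by move=> H1 H2; rewrite !size_takel // => ->.
  - by rewrite filter_uniq // allpairs_uniq ?words_le_uniq // => -[? ?] [? ?].
  move=> [w w']; rewrite mem_filter /=; apply/idP/idP.
    move=> /allpairsPdep[w1 [k [Hw1 _ [-> ->]]]]; rewrite cat_take_drop.
    move: (Hw1); rewrite mem_words_le => H; rewrite H /=; apply/allpairsP.
    exists (take k w1, drop k w1); rewrite !mem_words_le /=.
    by move: H; rewrite -{1}(cat_take_drop k w1) wdeg_cat => H; split=> //;
      apply: leq_trans H; rewrite ?leq_addr ?leq_addl.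
  move=> /andP[H _]; apply/allpairsPdep; exists (w ++ w'), (size w).
  rewrite take_size_cat // drop_size_cat // mem_words_le mem_iota size_cat.
  by split; rewrite ?add0n ?ltnS ?leq_addr.
transitivity (\sum_(p <- P2) G p.1 p.2).
  rewrite big_allpairs_dep; apply: eq_bigr => w _.
  by rewrite -(big_mkord predT (fun k => G (take k w) (drop k w))).
rewrite (perm_big _ P12) big_filter big_mkcond big_allpairs_dep /=.
apply: eq_bigr => w _; apply: eq_bigr => w' _ /=.
by case: leqP => // H; rewrite HG.
Qed.

Lemma tens_actM x f g : tens_act x (f * g) = tens_act (tens_act x f) g.
Proof.
apply: PLhatP => S; rewrite !(tens_actE _ _ (leqnn _)); set N := treesize S.
transitivity (\sum_(w <- words_le N) \sum_(w' <- words_le N)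
   f w * g w' * word_act (word_act x w) w' S).
  rewrite -(@words_le_split N (fun w w' => f w * g w' * word_act (word_act x w) w' S)).
    apply: eq_bigr => w _; rewrite tensM mulr_suml; apply: eq_bigr => k _.
    by rewrite -word_act_cat cat_take_drop.
  by move=> w w' H; rewrite -word_act_cat word_act_small ?mulr0 // ltnW.
rewrite exchange_big; apply: eq_bigr => w' _ /=.
rewrite (@word_act_lin N _ (words_le N) f (word_act x) (tens_act x f)) //; last first.
  by move=> T HT; rewrite (tens_actE _ _ HT).
by rewrite mulr_sumr; apply: eq_bigr => w _; rewrite mulrCA mulrA.
Qed.

Lemma tens_actD x f g S : tens_act x (f + g) S = tens_act x f S + tens_act x g S.
Proof.
rewrite !(tens_actE _ _ (leqnn _)) -big_split /=; apply: eq_bigr => w _.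
by rewrite tensD mulrDl.
Qed.

Lemma tens_actZ x a f S : tens_act x (a *: f) S = a * tens_act x f S.
Proof.
rewrite !(tens_actE _ _ (leqnn _)) mulr_sumr; apply: eq_bigr => w _.
by rewrite tensZ mulrA.
Qed.

Lemma tens_actB x f g S : tens_act x (f - g) S = tens_act x f S - tens_act x g S.
Proof. by rewrite tens_actD -scaleN1r tens_actZ mulN1r. Qed.

Lemma tens_act0 x : tens_act x 0 = 0.
Proof.
apply: PLhatP => S; rewrite (tens_actE _ _ (leqnn _)) big1 // => w _.
by rewrite tens0 mul0r.
Qed.

Lemma tens_act_sum x I r (P : pred I) (F : I -> tens) S :
  tens_act x (\sum_(i <- r | P i) F i) S = \sum_(i <- r | P i) tens_act x (F i) S.
Proof.
elim/big_rec2: _ => [|i u f _ <-]; first by rewrite tens_act0.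
by rewrite tens_actD.
Qed.

Lemma tens_act_word x w : tens_act x (tens_word w) = word_act x w.
Proof.
apply: PLhatP => S; rewrite (@tens_actE (treesize S + wdeg w)) ?leq_addr //.
rewrite (bigD1_seq w) ?words_le_uniq ?mem_words_le ?leq_addl //= big1 => [|v /negPf Hv].
  by rewrite /tens_word eqxx mul1r addr0.
by rewrite /tens_word Hv mul0r.
Qed.

Lemma tens_act0l f : tens_act 0 f = 0.
Proof.
apply: PLhatP => S; rewrite (tens_actE _ _ (leqnn _)) big1 // => w _.
by rewrite (@word_act_eq0 (treesize S)) ?mulr0 ?leq_addr.
Qed.

Lemma tens_act_elt x y : tens_act x (tens_elt y) = prelie x y.
Proof.
apply: PLhatP => S; set N := treesize S; rewrite (tens_actE _ _ (leqnn _)).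
transitivity (\sum_(w <- [seq [:: T] | T <- trees_le N & (treesize T <= N)%N])
   tens_elt y w * word_act x w S).
  rewrite (bigID (fun w => size w == 1%N)) /= [X in _ + X]big1 ?addr0; last first.
    by move=> [|T [|T' w]] //= _; rewrite mul0r.
  rewrite -big_filter; apply: perm_big; apply: uniq_perm.
  - by rewrite filter_uniq ?words_le_uniq.
  - by rewrite map_inj_uniq ?filter_uniq ?trees_le_uniq // => ? ? [].
  move=> w; rewrite mem_filter mem_words_le; apply/andP/mapP => [[]|].
    case: w => [|T [|T' w]] //= _; rewrite /wdeg big_seq1 => H.
    by exists T; rewrite // mem_filter H mem_trees_le.
  move=> [T]; rewrite mem_filter => /andP[H _] ->; split=> //.
  by rewrite /wdeg big_seq1.
rewrite big_map big_filter (prelieE _ _ (leqnn _)) exchange_big big_mkcond /=.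
apply: eq_bigr => T _; case: leqP => HT.
  rewrite (prelie_tree _ _ (leqnn _)) mulr_sumr; apply: eq_bigr => R _.
  by rewrite mulrA [y T * _]mulrC.
rewrite big1 // => R _; rewrite (@graft_count_big R T S N) // ?mulr0 //.
by rewrite HT orbT.
Qed.

Lemma tens_act_lie x T T' : tens_act x (tens_elt (lie (tree_elt T) (tree_elt T'))) =
  word_act x [:: T; T'] - word_act x [:: T'; T].
Proof.
rewrite tens_act_elt; apply: PLhatP => S; rewrite [RHS]/(_ - _) /=.
set N := treesize S.
have HA U V : prelie (prelie x (tree_elt U)) (tree_elt V) S =
  \sum_(R0 <- trees_le N) x R0 *
    (\sum_(R <- trees_le N) graft_count R0 U R * graft_count R V S)%N%:R.
  rewrite (prelie_tree _ _ (leqnn _)).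
  transitivity (\sum_(R <- trees_le N) \sum_(R0 <- trees_le N)
     x R0 * (graft_count R0 U R)%:R * (graft_count R V S)%:R).
    apply: eq_bigr => R _; rewrite -mulr_suml.
    case: (leqP (treesize R) N) => HR; first by rewrite (prelie_tree _ _ HR).
    by rewrite (@graft_count_big R V S N) ?HR // !mulr0.
  rewrite exchange_big; apply: eq_bigr => R0 _ /=; rewrite natr_sum mulr_sumr.
  by apply: eq_bigr => R _; rewrite natrM mulrA.
have HT U V R : (treesize R <= N)%N -> prelie (tree_elt U) (tree_elt V) R = (graft_count U V R)%:R :> K.
  move=> HR; rewrite (@prelie_tree (maxn N (treesize U))) ?(leq_trans HR) ?leq_maxl //.
  rewrite (bigD1_seq U) ?trees_le_uniq ?mem_trees_le ?leq_maxr //= big1 => [|R' /negPf H].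
    by rewrite /tree_elt eqxx mul1r addr0.
  by rewrite /tree_elt H mul0r.
have HB : prelie x (lie (tree_elt T) (tree_elt T')) S =
  \sum_(R0 <- trees_le N) x R0 *
    ((\sum_(R <- trees_le N) graft_count T T' R * graft_count R0 R S)%N%:R
     - (\sum_(R <- trees_le N) graft_count T' T R * graft_count R0 R S)%N%:R).
  rewrite (prelieE _ _ (leqnn _)); apply: eq_bigr => R0 _.
  rewrite !natr_sum -sumrB mulr_sumr; apply: eq_bigr => R _.
  case: (leqP (treesize R) N) => HR; last first.
    by rewrite (@graft_count_big R0 R S N) ?HR ?orbT // !muln0 subrr !mulr0.
  rewrite /lie [(_ - _ : PLhat) R]/(_ - _) !HT //.
  by rewrite !natrM -mulrBl mulrA.
rewrite [LHS]HB.
transitivity (prelie (prelie x (tree_elt T)) (tree_elt T') S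
  - prelie (prelie x (tree_elt T')) (tree_elt T) S); last by [].
rewrite !HA -sumrB; apply: eq_bigr => R0 _; rewrite -mulrBr; congr (_ * _).
have /(congr1 (fun n => n%:R : K)) := @graft_count_prelie N R0 T T' S (leqnn _).
rewrite !natrD => E; apply/eqP; rewrite subr_eq addrAC -subr_eq opprK; apply/eqP.
by rewrite [LHS]addrC [RHS]addrC -E addrC.
Qed.

Lemma tens_act_ideal x f : f \in envel_ideal -> tens_act x f = 0.
Proof.
move=> /envel_idealP Hf; apply: PLhatP => S; set N := treesize S.
have -> : tens_act x f S = tens_act x (\sum_(n < N.+1) hcomp n f) S.
  rewrite !(tens_actE _ _ (leqnn N)); apply: eq_big_seq => w; rewrite mem_words_le => Hw.
  rewrite tens_sum (bigD1 (Ordinal (Hw : (wdeg w < N.+1)%N))) //= big1.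
    by rewrite /hcomp eqxx addr0.
  by move=> i Hi; rewrite /hcomp; case: eqP => // E; case/eqP: Hi; apply: val_inj.
rewrite tens_act_sum big1 // => n _; have [s ->] := Hf n.
rewrite tens_act_sum big1 // => -[a [[w w'] [T T']]] _ /=.
rewrite tens_actZ !tens_actM [X in tens_act X _](_ : _ = 0).
  by rewrite tens_act0l mulr0.
apply: PLhatP => R; rewrite !tens_actB tens_act_lie !tens_act_word.
exact: subrr.
Qed.

(* This does not depend on the representative (Uact_proj), extends prelie     *)
(* (Uact_elt) and is a right action (UactM).                                  *)
Definition Uact (x : PLhat) (u : Uhat) : PLhat := tens_act x (Urepr u).

Lemma Uact_proj x f : Uact x (Uproj f) = tens_act x f.
Proof.
apply: PLhatP => S; apply/eqP; rewrite -subr_eq0 /Uact -tens_actB.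
by rewrite tens_act_ideal // Urepr_proj.
Qed.

Lemma Uact_elt x y : Uact x (Uproj (tens_elt y)) = prelie x y.
Proof. by rewrite Uact_proj tens_act_elt. Qed.

Lemma Uact1 x : Uact x 1 = x.
Proof. by rewrite [1]/(Uproj 1) Uact_proj tens_act_word. Qed.

Lemma UactM x u v : Uact x (u * v) = Uact (Uact x u) v.
Proof. by rewrite [u * v]/(Uproj _) Uact_proj tens_actM. Qed.

(* The value at u of the power series with coefficients a, meant for u with   *)
(* no component of degree 0: then u ^+ n has no component of degree less than *)
(* n, so that truncating at the degree loses nothing. By Useries_proj, this   *)
(* does not depend on representatives.                                        *)
Definition Useries (a : nat -> K) (u : Uhat) : Uhat :=
  Uproj (fun w => \sum_(n < (wdeg w).+1) a n * Urepr (u ^+ n) w).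

Lemma UprojX f n : Uproj (f ^+ n) = Uproj f ^+ n.
Proof. by elim: n => // n IH; rewrite !exprS UprojM IH. Qed.

Lemma Useries_proj a f : Useries a (Uproj f) =
  Uproj (fun w => \sum_(n < (wdeg w).+1) a n * (f ^+ n) w).
Proof.
apply/Uproj_eq/envel_idealP => d.
have -> : hcomp d ((fun w => \sum_(n < (wdeg w).+1) a n * Urepr (Uproj f ^+ n) w : K)
    - (fun w => \sum_(n < (wdeg w).+1) a n * (f ^+ n) w : K)) =
  \sum_(n < d.+1) a n *: hcomp d (Urepr (Uproj f ^+ n) - f ^+ n).
  apply: tensP => w; rewrite tens_sum hcompE tensB -sumrB.
  case: eqP => [E|/eqP/negPf Hd].
    rewrite mul1r E; apply: eq_bigr => n _.
    by rewrite tensZ hcompE E eqxx mul1r tensB mulrBr.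
  by rewrite mul0r big1 // => n _; rewrite tensZ hcompE Hd mul0r mulr0.
apply: envel_span_sum => n _; apply: envel_spanZ; rewrite -UprojX.
exact/envel_idealP/Urepr_proj.
Qed.

Definition exp_coef (n : nat) : K := (n`!)%:R^-1.

Fixpoint bern_seq (n : nat) : seq K :=
  if n is m.+1 then
    rcons (bern_seq m)
      ((m == 0%N)%:R - \sum_(k < m) (bern_seq m)`_k / (m.+1 - k)`!%:R)
  else [::].

(* The coefficients of the power series x / (exp x - 1).                      *)
Definition bern_coef (n : nat) : K := (bern_seq n.+1)`_n.

Lemma bern_coefP n :
  \sum_(k < n.+1) bern_coef k / (n.+1 - k)`!%:R = (n == 0%N)%:R.
Proof.
have ss m : size (bern_seq m) = m by elim: m => //= m IH; rewrite size_rcons IH.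
have sn m k : (k < m)%N -> (bern_seq m)`_k = bern_coef k.
  elim: m => // m IH; rewrite ltnS leq_eqVlt => /orP[/eqP -> //|H].
  by rewrite /= nth_rcons ss H IH.
rewrite big_ord_recr /= subSnn factS fact0 muln1 divr1.
rewrite {2}/bern_coef /= nth_rcons ss ltnn eqxx.
rewrite addrC (eq_bigr (fun k : 'I_n => bern_coef k / (n.+1 - k)`!%:R)) ?subrK //.
by move=> k _; rewrite sn.
Qed.

Definition PL_to_U (x : PLhat) : Uhat := Uproj (tens_elt x).

Definition Uexp (x : PLhat) : Uhat := Useries exp_coef (PL_to_U x).

Definition Ubern (x : PLhat) : Uhat := Useries bern_coef (PL_to_U x).

Definition bullet : PLhat := tree_elt dot.

(* For x = \sum_n x_n with x_n homogeneous of degree n, this is the sum of    *)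
(* the t ^+ n *: x_n.                                                         *)
Definition dilate (t : K) (x : PLhat) : PLhat := fun T => t ^+ treesize T * x T.

Definition is_Omega (x : PLhat) : Prop := Uact bullet (Ubern x) = x.

Lemma tens_eltX x n w :
  (tens_elt x ^+ n) w = (size w == n)%:R * \prod_(T <- w) x T.
Proof.
elim: n w => [|n IH] w.
  case: w => [|T w]; last by rewrite mul0r.
  by rewrite big_nil mulr1.
rewrite exprS; case: w => [|T w].
  by rewrite [LHS]tens_mul_nil !mul0r.
rewrite [LHS]tens_mul_cons mul0r add0r.
have -> : tens_shift (tens_elt x) T = x T *: (1 : tens).
  by apply: tensP => -[|T' v]; rewrite tensZ ?mulr1 ?mulr0.
by rewrite tens_mulZl tens_mul1l tensZ IH big_cons mulrCA.
Qed.

Lemma Useries_elt a x : Useries a (PL_to_U x) =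
  Uproj (fun w => a (size w) * \prod_(T <- w) x T).
Proof.
rewrite Useries_proj; congr Uproj; apply: tensP => w.
rewrite (bigD1 (Ordinal (size_wdeg w : (size w < (wdeg w).+1)%N))) //= big1.
  by rewrite tens_eltX eqxx mul1r addr0.
move=> i Hi; rewrite tens_eltX; case: eqP => [E|_]; last by rewrite mul0r mulr0.
by case/eqP: Hi; apply: val_inj.
Qed.

Definition agree (n : nat) (x y : PLhat) : Prop :=
  forall T, (treesize T < n)%N -> x T = y T.

Lemma PLhat_fixpoint (F : PLhat -> PLhat) :
  (forall n x y, agree n x y -> agree n.+1 (F x) (F y)) ->
  exists! x : PLhat, F x = x.
Proof.
move=> HF; pose z n : PLhat := iter n F 0.
have Hz n : agree n.+1 (z n) (z n.+1).
  elim: n => [|n IH]; last exact: HF.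
  by move=> T; rewrite ltnS leqn0 => /eqP E; have := treesize_gt0 T; rewrite E.
have Hzm n m : agree n.+1 (z n) (z (n + m)%N).
  elim: m => [|m IH] T HT; first by rewrite addn0.
  rewrite IH // addnS; apply: Hz; apply: leq_trans HT _.
  by rewrite ltnS leq_addr.
pose x : PLhat := fun T => z (treesize T) T.
have Hx n : agree n.+1 (z n) x.
  by move=> T HT; rewrite /x -(subnKC (HT : (treesize T <= n)%N)) -Hzm.
exists x; split=> [|y Hy].
  apply: PLhatP => T; rewrite -[RHS](Hx (treesize T).+1) ?ltnS ?leqnSn //.
  apply: (HF (treesize T).+1); last by rewrite ltnS leqnSn.
  by move=> R HR; apply/esym/Hx.
have H n : agree n x y.
  elim: n => // n IH T HT; rewrite -(Hx n T HT) -Hy.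
  case: n IH HT => [|n] IH HT; first by have := treesize_gt0 T; case: (treesize T) HT.
  by apply: (HF n.+1) HT => R HR; rewrite -IH //; exact: Hx.
by apply: PLhatP => T; apply: (H (treesize T).+1).
Qed.

Lemma Uact_series_agree a n x y z : agree n y z ->
  agree n.+1 (Uact x (Useries a (PL_to_U y))) (Uact x (Useries a (PL_to_U z))).
Proof.
move=> H S HS; rewrite !Useries_elt !Uact_proj !(tens_actE _ _ (leqnn _)).
apply: eq_bigr => w _; case: (leqP (treesize S) (wdeg w)) => Hw.
  by rewrite word_act_small ?mulr0.
congr (_ * _ * _); apply: eq_big_seq => T HT; apply: H.
apply: leq_trans (HS : (treesize S <= n)%N); apply: leq_ltn_trans Hw.
by rewrite /wdeg (big_rem T) //= leq_addr.
Qed.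

Lemma Omega_exists_unique : exists! x, is_Omega x.
Proof. by apply: PLhat_fixpoint => n x y; apply: Uact_series_agree. Qed.

End Algebra.

Notation Qq := {fraction {poly rat}}.

Local Notation "x %:F" := (@FracField.tofrac _ x).

Definition Qq_const (a : rat) : Qq := (a%:P)%:F.

Definition qvar : Qq := 'X%:F.

Definition is_Omegaq (Om : PLhat rat) (x : PLhat Qq) : Prop :=
  Uact (dilate qvar x) (Uexp (Qq_const \o Om) - 1) + dilate qvar x - x
  = prelie (bullet Qq) x + (qvar - 1) *: bullet Qq.

(* The rational function f tends to l at infinity; the choice of the fraction *)
(* a / b representing f does not matter.                                      *)
Definition lim_infty (f : Qq) (l : rat) : Prop :=
  exists a b : {poly rat}, [/\ b != 0, f = a%:F / b%:F &
    forall e : rat, 0 < e -> exists M : rat, forall x : rat,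
      M < `|x| -> `|a.[x] / b.[x] - l| < e].

Definition coef_lim_infty (x : PLhat Qq) (y : PLhat rat) : Prop :=
  forall T, lim_infty (x T) (y T).

Lemma word_act_agree (K : fieldType) m (x y : PLhat K) w :
  agree m x y -> agree (m + wdeg w) (word_act x w) (word_act y w).
Proof.
elim: w m x y => [|T w IH] m x y Hxy.
  by rewrite /wdeg big_nil addn0.
rewrite wdeg_cons addnA; apply: IH => R HR.
rewrite !(prelie_tree _ _ (leqnn _)); apply: eq_bigr => R' _.
case: (graft_count R' T R =P 0%N) => [->|/eqP /graft_count_neq0 E].
  by rewrite !mulr0.
by rewrite Hxy //; move: HR; rewrite E ltn_add2r.
Qed.

Lemma prelie_agree (K : fieldType) n (x y z : PLhat K) :
  agree n y z -> agree n.+1 (prelie x y) (prelie x z).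
Proof.
move=> H S HS; rewrite !(prelieE _ _ (leqnn _)).
apply: eq_bigr => T _; apply: eq_bigr => T' _.
case: (graft_count T T' S =P 0%N) => [->|/eqP /graft_count_neq0 E].
  by rewrite !mulr0.
rewrite H //; apply: leq_trans (HS : (treesize S <= n)%N).
by rewrite E -addn1 addnC leq_add2r treesize_gt0.
Qed.

Lemma Uact_expB1 (K : fieldType) (x om : PLhat K) S : Uact x (Uexp om - 1) S =
  \sum_(w <- words_le (treesize S) | w != [::])
     exp_coef K (size w) * (\prod_(T <- w) om T) * word_act x w S.
Proof.
rewrite /Uexp Useries_elt -[_ - 1]UprojB.
rewrite Uact_proj tens_actB (tens_actE _ _ (leqnn _)) tens_act_word.
rewrite (bigD1_seq [::]) ?words_le_uniq //=; last first.
  by rewrite mem_words_le /wdeg big_nil.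
rewrite big_nil mulr1 /exp_coef fact0 invr1 mul1r.
by rewrite addrAC subrr add0r.
Qed.

Lemma qvarX_neq1 n : (0 < n)%N -> qvar ^+ n - 1 != 0.
Proof.
move=> Hn; rewrite subr_eq0 /qvar -rmorphXn -[X in _ != X](rmorph1 (@FracField.tofrac _)).
rewrite tofrac_eq; apply/eqP => /(congr1 (fun p : {poly rat} => size p)).
by rewrite size_polyXn size_poly1 => -[E]; rewrite E in Hn.
Qed.

Lemma Omegaq_exists_unique (Om : PLhat rat) : exists! x, is_Omegaq Om x.
Proof.
pose om : PLhat Qq := Qq_const \o Om.
pose G (x : PLhat Qq) : PLhat Qq := prelie (bullet Qq) x
  + (qvar - 1) *: bullet Qq - Uact (dilate qvar x) (Uexp om - 1).
pose F (x : PLhat Qq) : PLhat Qq := fun T => (qvar ^+ treesize T - 1)^-1 * G x T.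
have HFix x : is_Omegaq Om x <-> F x = x.
  rewrite /is_Omegaq -/om.
  have EG : G x = dilate qvar x - x <->
      Uact (dilate qvar x) (Uexp om - 1) + dilate qvar x - x =
      prelie (bullet Qq) x + (qvar - 1) *: bullet Qq.
    rewrite /G -(addrA (Uact _ _)); split=> [/eqP|<-]; last by rewrite [LHS]addrC addKr.
    by rewrite subr_eq addrC => /eqP ->.
  have ED T : (dilate qvar x - x) T = (qvar ^+ treesize T - 1) * x T.
    by rewrite mulrBl mul1r.
  have Hn T : qvar ^+ treesize T - 1 != 0 by apply/qvarX_neq1/treesize_gt0.
  rewrite -EG; split=> E; apply: PLhatP => T.
    by rewrite /F E ED mulKf.
  by rewrite ED -{2}E /F mulVKf.
have [|x [Hx Hu]] := @PLhat_fixpoint Qq F.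
  move=> n x y Hxy T HT; rewrite /F; congr (_ * _).
  rewrite /G [LHS]/(_ + _ - _) [RHS]/(_ + _ - _); congr (_ + _ - _).
    exact: (prelie_agree _ Hxy).
  rewrite !Uact_expB1; apply: eq_bigr => w Hw; congr (_ * _).
  apply: (@word_act_agree _ n).
    by move=> R HR; rewrite /dilate Hxy.
  apply: leq_trans HT _; rewrite -addn1 leq_add2l.
  by case: w Hw => // R w _; rewrite wdeg_cons addn_gt0 treesize_gt0.
exists x; split=> [|y /HFix]; [exact/HFix | exact: Hu].
Qed.

(* Main.v *)
Require Import Defs.
From HB Require Import structures.
From mathcomp Require Import all_boot all_order all_algebra perm.
From mathcomp Require Import boolp.
From mathcomp Require Import ring lra.

(* In the limit q -> oo the equation for Omega_q becomes                      *)
(* Omega_infty <- exp(Omega) = bullet, so one has to show that the series A   *)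
(* with coefficients (-1)^(#T-1) / aut T satisfies A <- exp(Omega) = bullet.  *)
(* In the coordinates x_T * aut T the pre-Lie product becomes a sum over the  *)
(* edges of a tree: each edge is cut, x is evaluated on the trunk and y on    *)
(* the branch.  Then x <- exp(t Omega) is the sum over the admissible cuts of *)
(* x(trunk) * \prod b_t(branch), where b_t = Omega <- (exp(t Omega) - 1)/Omega, *)
(* because both satisfy the same differential equation in t.  The equation    *)
(* for Omega says that b_1 = bullet, so x <- exp(Omega) sums x over all ways  *)
(* to remove a set of leaves; for the signs of A these sums cancel except on  *)
(* the one-vertex tree.                                                       *)

(** Put y = [Omega_q][q]/q, so that the coefficient of [Omega_q] at T is q^(1-#T) y_T. After
    division of its equation by q, the terms in [Omega_q] itself vanish in the limit. At T the
    remaining terms involve y only on smaller trees, apart from y_T ([Omegaq_solve]). By induction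
    on #T, y converges to the series A with A <- exp(Omega) = bullet.

    That the alternating series solves this equation is [Uact_Omega_infty]. Its ingredients are: the
    double count [graft_count_aut], which turns the pre-Lie product into a sum over edges without
    multiplicities ([pcoord_prelie]); [exp_cutprod], which turns the exponential into a sum over
    admissible cuts; [bullet_Omega], which forces the branches cut off to be single vertices; and
    the cancellation [admcut_sign]. Planar trees suffice as representatives by [ltree_of_surj]. *)

Set Implicit Arguments.
Unset Strict Implicit.
Unset Printing Implicit Defensive.

Import Order.TTheory GRing.Theory Num.Theory.

Local Open Scope ring_scope.
Local Open Scope quotient_scope.

(** * Cuts of planar trees *)

(* Planar rooted trees: [Gr A B] is A with B added as a branch at the root.   *)
Inductive ptree := Single | Gr of ptree & ptree.

HB.instance Definition _ := gen_eqMixin ptree.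

Definition is_single P := if P is Single then true else false.

Fixpoint bsize P := if P is Gr A B then (bsize A + bsize B)%N else 1%N.

Lemma bsize_gt0 P : (0 < bsize P)%N.
Proof. by elim: P => //= A HA B HB; rewrite addn_gt0 HA. Qed.

(* The pairs (trunk, branch) obtained by cutting one edge.                    *)
Fixpoint cuts P : seq (ptree * ptree) :=
  if P is Gr A B then
    (A, B) :: [seq (Gr c.1 B, c.2) | c <- cuts A] ++ [seq (Gr A c.1, c.2) | c <- cuts B]
  else [::].

Section CutProduct.
Variable R : comNzRingType.
Implicit Types (x y a b : ptree -> R) (P : ptree).

Definition cutprod x y P := \sum_(c <- cuts P) x c.1 * y c.2.

Lemma cutprod_Gr x y A B : cutprod x y (Gr A B) =
  x A * y B + cutprod (fun T => x (Gr T B)) y A + cutprod (fun T => x (Gr A T)) y B.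
Proof. by rewrite /cutprod /= big_cons big_cat !big_map addrA. Qed.

(** A cut removes at least one vertex, so every trunk of P has at most m vertices. *)
Lemma cutprod_eq0 m x y : (forall P, (bsize P <= m)%N -> x P = 0) ->
  forall P, (bsize P <= m.+1)%N -> cutprod x y P = 0.
Proof.
move=> Hx P; elim: P m x Hx => [|A IHA B IHB] m x Hx; first by rewrite /cutprod big_nil.
rewrite cutprod_Gr /= => H.
have HB : (bsize A <= m)%N by rewrite -ltnS (leq_trans _ H) // -addn1 leq_add2l bsize_gt0.
rewrite Hx // mul0r add0r.
(* Cuts inside A leave B in the trunk, so the vanishing bound on the part of the trunk in A drops by
   the size of B; symmetrically for B. *)
rewrite (IHA (m - bsize B)%N) ?(IHB (m - bsize A)%N) ?addr0 //.
- by move=> P HP; rewrite Hx //= -(subnKC HB) leq_add2l.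
- by rewrite -subSn // leq_subRL ?(leqW HB).
- have HA : (bsize B <= m)%N.
    by rewrite -ltnS (leq_trans _ H) // -add1n leq_add2r bsize_gt0.
  by move=> P HP; rewrite Hx //= -(subnK HA) leq_add2r.
- have HA : (bsize B <= m)%N.
    by rewrite -ltnS (leq_trans _ H) // -add1n leq_add2r bsize_gt0.
  by rewrite -subSn // leq_subRL ?(leqW HA) // addnC.
Qed.

Lemma iter_cutprod_eq0 x y n P :
  (bsize P <= n)%N -> iter n (fun z => cutprod z y) x P = 0.
Proof.
elim: n P => [|n IH] P; first by rewrite leqNgt bsize_gt0.
exact: cutprod_eq0.
Qed.

(* The sum, over the admissible cuts of P, of the value of a on the trunk     *)
(* times the product of the values of b on the branches.                      *)
Fixpoint admcut b P a : R :=
  if P is Gr A B then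
    admcut b A a * b B + admcut b A (fun T => admcut b B (fun U => a (Gr T U)))
  else a Single.

Lemma eq_admcut b b' a a' P : b =1 b' -> a =1 a' -> admcut b P a = admcut b' P a'.
Proof.
move=> Hb; elim: P a a' => [|A IHA B IHB] a a' Ha /=; first exact: Ha.
by rewrite Hb (IHA a a') // (IHA _ _ (fun T => IHB _ _ (fun U => Ha (Gr T U)))).
Qed.

Lemma admcutD b a a' P :
  admcut b P (fun T => a T + a' T) = admcut b P a + admcut b P a'.
Proof.
elim: P a a' => //= A IHA B IHB a a'.
rewrite (eq_admcut (a' := fun T => admcut b B _ + admcut b B _) A (frefl b) (fun T => IHB _ _)).
by rewrite !IHA mulrDl addrACA.
Qed.

Lemma admcutZ k b a P : admcut b P (fun T => k * a T) = k * admcut b P a.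
Proof.
elim: P a => //= A IHA B IHB a.
rewrite -[X in _ + X](eq_admcut (a := fun T => k * _) _ (frefl b) (fun T => esym (IHB _))).
by rewrite !IHA mulrDr mulrA.
Qed.

Lemma admcut0 b P : admcut b P (fun=> 0) = 0.
Proof.
rewrite -[RHS](mul0r (admcut b P (fun=> 0))) -admcutZ.
by apply: eq_admcut => // T; rewrite mul0r.
Qed.

Lemma admcut_sum b I (r : seq I) (F : I -> ptree -> R) P :
  admcut b P (fun T => \sum_(i <- r) F i T) = \sum_(i <- r) admcut b P (F i).
Proof.
elim: r => [|i r IH].
  rewrite big_nil -[RHS](admcut0 b P).
  by apply: eq_admcut => // T; rewrite big_nil.
rewrite big_cons -IH -admcutD.
by apply: eq_admcut => // T; rewrite big_cons.
Qed.

(** Only the empty cut survives; this is the initial condition of the flow at t = 0. *)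
Lemma admcut_nobranch a P : admcut (fun=> 0) P a = a P.
Proof. by elim: P a => //= A IHA B IHB a; rewrite mulr0 add0r IHA IHB. Qed.

(* Cutting off exactly the branches reduced to one vertex: the cuts of a set  *)
(* of leaves cancel in pairs.                                                 *)
Lemma admcut_sign P :
  admcut (fun P => (is_single P)%:R) P (fun P => (-1) ^+ (bsize P).-1) = (is_single P)%:R.
Proof.
elim: P => //= A IHA B IHB.
rewrite IHA.
(* Cutting the edge to B gave the first term. Keeping it gives the same product with opposite sign:
   joining trunks T and U adds one edge, hence one factor -1. *)
rewrite (eq_admcut (b' := fun P => (is_single P)%:R)
  (a' := fun T => (- (is_single B)%:R) * (-1) ^+ (bsize T).-1)) //.
  by rewrite admcutZ IHA mulNr mulrC subrr.
move=> T; rewrite -IHB mulrC mulrN -mulNr -admcutZ; apply: eq_admcut => // U.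
rewrite -[bsize T in LHS](prednK (bsize_gt0 T)) -[bsize U in LHS](prednK (bsize_gt0 U)).
by rewrite addnS addSn /= exprS exprD mulN1r mulNr.
Qed.

End CutProduct.

(** Leibniz rule over the branches. Cut one edge of P, evaluate [o] on the piece U removed, then cut
    the rest admissibly. If U hangs from the final trunk, it is itself a branch of P and gives the
    term [o]; if it hangs inside another branch, it gives the term [cutprod b o] of that branch. *)
Lemma admcut_deriv (R : comNzRingType) (o : ptree -> R) (b : ptree -> {poly R}) :
  (forall P, (b P)^`() = (o P)%:P + cutprod b (polyC \o o) P) ->
  forall P a, (admcut b P a)^`() =
    admcut b P (fun T => (a T)^`()) + cutprod (fun Q => admcut b Q a) (polyC \o o) P.
Proof.
move=> Hb; elim=> [|A IHA B IHB] a; first by rewrite /cutprod big_nil addr0.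
rewrite /= derivD derivM Hb !IHA cutprod_Gr /=.
have -> : admcut b A (fun T => (admcut b B (fun U => a (Gr T U)))^`()) =
  admcut b A (fun T => admcut b B (fun U => (a (Gr T U))^`())) +
  \sum_(c <- cuts B) admcut b A (fun T => admcut b c.1 (fun U => a (Gr T U)) * (o c.2)%:P).
  by rewrite -admcut_sum -admcutD; apply: eq_admcut => // T; rewrite IHB.
have -> : cutprod (fun T => admcut b T a * b B +
    admcut b T (fun T0 => admcut b B (fun U => a (Gr T0 U)))) (polyC \o o) A =
  cutprod (fun Q => admcut b Q a) (polyC \o o) A * b B +
  cutprod (fun Q => admcut b Q (fun T0 => admcut b B (fun U => a (Gr T0 U)))) (polyC \o o) A.
  rewrite /cutprod mulr_suml -big_split; apply: eq_bigr => c _ /=.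
  by rewrite mulrDl mulrAC.
have -> : cutprod (fun T => admcut b A a * b T +
    admcut b A (fun T0 => admcut b T (fun U => a (Gr T0 U)))) (polyC \o o) B =
  admcut b A a * cutprod b (polyC \o o) B +
  \sum_(c <- cuts B) admcut b A (fun T => admcut b c.1 (fun U => a (Gr T U)) * (o c.2)%:P).
  rewrite /cutprod mulr_sumr -big_split; apply: eq_bigr => c _ /=.
  rewrite mulrDl mulrA; congr (_ + _); rewrite mulrC -admcutZ.
  by apply: eq_admcut => // T; rewrite mulrC.
rewrite /=; ring.
Qed.

Lemma admcut_horner (R : comNzRingType) (b a : ptree -> {poly R}) P t :
  (admcut b P a).[t] = admcut (fun P => (b P).[t]) P (fun P => (a P).[t]).
Proof.
elim: P a => //= A IHA B IHB a; rewrite hornerD hornerM !IHA; congr (_ + _).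
by apply: eq_admcut => // T; rewrite IHB.
Qed.

(* The flow t |-> x <- exp(t o) of right multiplication by o is the family of *)
(* admissible cuts with branches b_t = o <- (exp(t o) - 1) / o: both satisfy  *)
(* the same differential equation in t; beta is b_1.                          *)
Lemma exp_cutprod (F : numFieldType) (o a beta : ptree -> F) N P :
  (forall P n, (bsize P <= n)%N ->
    beta P = \sum_(k < n.+1) (k.+1)`!%:R^-1 * iter k (fun z => cutprod z o) o P) ->
  (bsize P <= N)%N ->
  \sum_(n < N.+1) (n`!)%:R^-1 * iter n (fun z => cutprod z o) a P = admcut beta P a.
Proof.
move=> Hbeta HN.
pose bc (n : nat) (P : ptree) : F :=
  if n is m.+1 then (m.+1)`!%:R^-1 * iter m (fun z => cutprod z o) o P else 0.
have bc0 n Q : (bsize Q < n)%N -> bc n Q = 0.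
  by case: n => // n H; rewrite /bc iter_cutprod_eq0 ?mulr0.
(* Coefficients vanish beyond degree [bsize P]; this bound is chosen so that removing the zero
   constant term leaves exactly the sum of [Hbeta] for n = [bsize P]. *)
pose b (P : ptree) : {poly F} := \poly_(n < (bsize P).+2) bc n P.
have bE Q n : (b Q)`_n = bc n Q.
  by rewrite coef_poly; case: ltnP => // H; rewrite bc0 // ltnW.
have facK n : (n.+1)`!%:R^-1 *+ n.+1 = (n`!)%:R^-1 :> F.
  rewrite -[LHS]mulr_natr factS natrM invfM mulrAC mulVf ?mul1r //.
  by rewrite pnatr_eq0.
have Hb Q : (b Q)^`() = (o Q)%:P + cutprod b (polyC \o o) Q.
  apply/polyP => n; rewrite coef_deriv bE coefD coefC /cutprod coef_sum /=.
  under eq_bigr do rewrite coefMC bE.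
  rewrite -mulrnAl facK; case: n => [|n] /=.
    rewrite fact0 invr1 mul1r big1 ?addr0 // => c _; exact: mul0r.
  by rewrite add0r mulr_sumr; apply: eq_bigr => c _; rewrite mulrA.
pose g Q := admcut b Q (polyC \o a).
(* The differential equation for [g] read on coefficients is the recursion of the exponential
   series. *)
have gE n Q : (g Q)`_n = (n`!)%:R^-1 * iter n (fun z => cutprod z o) a Q.
  elim: n Q => [|n IH] Q.
    rewrite fact0 invr1 mul1r -horner_coef0 admcut_horner /= -[RHS]admcut_nobranch.
    by apply: eq_admcut => T /=; rewrite ?hornerC // horner_coef0 bE.
  have /(congr1 (fun p : {poly F} => p`_n)) := admcut_deriv Hb Q (polyC \o a).
  have Ea : (fun T => ((polyC \o a) T)^`()) =1 fun=> 0 by move=> T; rewrite /= derivC.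
  rewrite coef_deriv coefD (eq_admcut Q (frefl b) Ea).
  rewrite admcut0 coef0 add0r /cutprod coef_sum => E.
  apply: (mulIf (_ : n.+1%:R != 0)); first by rewrite pnatr_eq0.
  rewrite mulr_natr -/(g Q) E mulrAC mulr_natr facK mulr_sumr.
  by apply: eq_bigr => c _; rewrite coefMC IH mulrA.
transitivity (g P).[1].
  rewrite (horner_coef_wide (n := N.+1)).
    by apply: eq_bigr => i _; rewrite gE expr1n mulr1.
  apply/leq_sizeP => j Hj; rewrite gE iter_cutprod_eq0 ?mulr0 //.
  exact: leq_trans HN (ltnW Hj).
rewrite admcut_horner; apply: eq_admcut => Q /=; last by rewrite hornerC.
rewrite (horner_coef_wide (n := (bsize Q).+2)) ?size_poly // big_ord_recl bE mul0r add0r.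
rewrite (Hbeta Q (bsize Q)) //.
by apply: eq_bigr => i _; rewrite bE expr1n mulr1.
Qed.

(** * Isomorphisms and edges *)

Definition troot (t : ltree) : vertex t := projT1 (cid (Defs.rootP t)).

Lemma parent_troot t : parent t (troot t) = troot t.
Proof. by rewrite /troot; case: cid => r [] /=. Qed.

Lemma iter_parent_troot t v : exists k, iter k (parent t) v = troot t.
Proof. by rewrite /troot; case: cid => r [] /=. Qed.

Lemma parent_fix t v : (parent t v == v) = (v == troot t).
Proof.
apply/eqP/eqP => [H|->]; last exact: parent_troot.
exact: parent_fix_uniq H (parent_troot t).
Qed.

(** The map is kept explicit, unlike in [tree_iso], because isomorphisms will be counted and the
    image of a marked edge followed. *)
Definition is_iso t t' (f : vertex t -> vertex t') :=
  bijective f /\ forall v, f (parent t v) = parent t' (f v).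

Lemma is_iso_tree_iso t t' (f : vertex t -> vertex t') : is_iso f -> tree_iso t t'.
Proof. by move=> [bf Hf]; apply/asboolP; exists f. Qed.

Lemma tree_iso_is_iso t t' : tree_iso t t' -> exists f : vertex t -> vertex t', is_iso f.
Proof. by move=> /asboolP[f bf Hf]; exists f. Qed.

Lemma is_iso_comp t1 t2 t3 (g : vertex t2 -> vertex t3) (f : vertex t1 -> vertex t2) :
  is_iso g -> is_iso f -> is_iso (g \o f).
Proof.
move=> [bg Hg] [bf Hf]; split; first exact: bij_comp.
by move=> v /=; rewrite Hf Hg.
Qed.

Lemma is_iso_inv t t' (f : vertex t -> vertex t') :
  is_iso f -> exists g, [/\ is_iso g, cancel f g & cancel g f].
Proof.
move=> [[g fK gK] Hf]; exists g; split=> //; split; first by exists f.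
by move=> v; rewrite -{1}(gK v) -Hf fK.
Qed.

Lemma is_iso_troot t t' (f : vertex t -> vertex t') : is_iso f -> f (troot t) = troot t'.
Proof. by move=> [_ Hf]; apply/eqP; rewrite -parent_fix -Hf parent_troot. Qed.

Lemma troot_graft t v t' : troot (@graft t v t') = lshift _ (troot t).
Proof. by apply/esym/eqP; rewrite -parent_fix graft_parentl parent_troot. Qed.

Definition graft_fun t v t' s w s' (f : vertex t -> vertex s) (g : vertex t' -> vertex s')
    (i : vertex (@graft t v t')) : vertex (@graft s w s') :=
  match fintype.split i with inl a => lshift _ (f a) | inr b => rshift _ (g b) end.

Lemma graft_funl t v t' s w s' f g a :
  @graft_fun t v t' s w s' f g (lshift _ a) = lshift _ (f a).
Proof. by rewrite /graft_fun split_lshift. Qed.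

Lemma graft_funr t v t' s w s' f g b :
  @graft_fun t v t' s w s' f g (rshift _ b) = rshift _ (g b).
Proof. by rewrite /graft_fun split_rshift. Qed.

Lemma graft_fun_iso t v t' s w s' f g : is_iso f -> is_iso g -> f v = w ->
  is_iso (@graft_fun t v t' s w s' f g).
Proof.
move=> [[f' fK f'K] Hf] [[g' gK g'K] Hg] fv; split.
  exists (@graft_fun s w s' t v t' f' g') => i; case: (split_ordP i) => j ->;
  by rewrite ?(graft_funl, graft_funr) ?fK ?gK ?f'K ?g'K.
move=> i; case: (split_ordP i) => j ->.
  by rewrite graft_parentl !graft_funl graft_parentl Hf.
rewrite graft_parentr graft_funr graft_parentr -Hg (can_eq gK).
by case: eqP => _; rewrite ?graft_funl ?graft_funr ?fv.
Qed.

(** This map and [graft_assoc] make explicit the isomorphisms behind [graft_graftl] and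
    [graft_graftr]; [sum_cuts] uses them to bring the marked edge to the outermost graft. *)
Definition graft_swapl t v w s r (i : vertex (@graft (@graft t v s) (lshift _ w) r)) :
    vertex (@graft (@graft t w r) (lshift _ v) s) :=
  match fintype.split i with
  | inl j => match fintype.split j with
             | inl a => lshift _ (lshift _ a) | inr b => rshift _ b end
  | inr c => lshift _ (rshift _ c)
  end.

Lemma graft_swapl_iso t v w s r : is_iso (@graft_swapl t v w s r).
Proof.
have FK s' r' v' w' : cancel (@graft_swapl t v' w' s' r') (@graft_swapl t w' v' r' s').
  rewrite /graft_swapl => i; case: (split_ordP i) => j -> /=; last by rewrite !(split_lshift, split_rshift).
  by case: (split_ordP j) => k -> /=; rewrite !(split_lshift, split_rshift).
split; first by exists (@graft_swapl t w v r s); apply: FK.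
rewrite /graft_swapl => i; case: (split_ordP i) => j ->.
  rewrite graft_parentl split_lshift; case: (split_ordP j) => k ->.
    by rewrite !graft_parentl split_lshift.
  rewrite !graft_parentr; case: (parent s k =P k) => _.
    by rewrite split_lshift.
  by rewrite split_rshift.
rewrite graft_parentr graft_parentl graft_parentr.
case: (parent r j =P j) => _; first by rewrite !split_lshift.
by rewrite split_rshift.
Qed.

Definition graft_assoc t v s w r (i : vertex (@graft t v (@graft s w r))) :
    vertex (@graft (@graft t v s) (rshift _ w) r) :=
  match fintype.split i with
  | inl a => lshift _ (lshift _ a)
  | inr j => match fintype.split j with
             | inl b => lshift _ (rshift _ b) | inr c => rshift _ c end
  end.

Lemma graft_assoc_iso t v s w r : is_iso (@graft_assoc t v s w r).
Proof.
split.
  exists (fun i : vertex (@graft (@graft t v s) (rshift _ w) r) =>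
  match fintype.split i with
  | inl j => match fintype.split j with
             | inl a => lshift _ a | inr b => rshift _ (lshift _ b) end
  | inr c => rshift _ (rshift _ c) end) => i.
    rewrite /graft_assoc; case: (split_ordP i) => j ->; rewrite ?(split_lshift, split_rshift) //.
    by case: (split_ordP j) => k ->; rewrite ?(split_lshift, split_rshift).
  rewrite /graft_assoc; case: (split_ordP i) => j ->; rewrite ?split_lshift ?split_rshift //.
  by case: (split_ordP j) => k ->; rewrite ?(split_lshift, split_rshift).
rewrite /graft_assoc => i; case: (split_ordP i) => j ->.
  by rewrite !(graft_parentl, split_lshift).
rewrite graft_parentr; case: (split_ordP j) => k ->.
  rewrite !graft_parentl eq_lshift graft_parentr.
  by case: eqP => _; rewrite ?split_lshift // ?split_rshift ?split_lshift.
rewrite !graft_parentr; case: (parent r k =P k) => [_|/eqP Hk].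
  by rewrite eq_lrshift split_rshift split_lshift.
by rewrite eq_rshift (negPf Hk) !split_rshift.
Qed.

Fixpoint ltree_of P : ltree :=
  if P is Gr A B then graft (troot (ltree_of A)) (ltree_of B) else dot_ltree.

Lemma nverts_ltree_of P : nverts (ltree_of P) = bsize P.
Proof. by elim: P => //= A <- B <-. Qed.

(* A non-root vertex e stands for the edge above it; grafting s' on s singles *)
(* out the edge above the root of s'.                                         *)
Lemma sum_cuts (R : nmodType) (Phi : forall s, vertex s -> R) (Psi : ltree -> ltree -> R) :
  (forall s s' f e, @is_iso s s' f -> Phi s e = Phi s' (f e)) ->
  (forall s w s', Phi (@graft s w s') (rshift _ (troot s')) = Psi s s') ->
  forall P, \sum_(e | e != troot (ltree_of P)) Phi (ltree_of P) e =
    \sum_(c <- cuts P) Psi (ltree_of c.1) (ltree_of c.2).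
Proof.
move=> HPhi HPsi P; elim: P Phi Psi HPhi HPsi => [|A IHA B IHB] Phi Psi HPhi HPsi.
  by rewrite big_nil big1 // => e; rewrite [e]ord1 [troot _]ord1 eqxx.
rewrite /= big_cons big_cat !big_map /= troot_graft big_mkcond big_split_ord /=.
rewrite [in X in X + _](eq_bigr (fun e => if e != troot (ltree_of A) then
  Phi (graft (troot (ltree_of A)) (ltree_of B)) (lshift _ e) else 0)) => [|e _]; last by rewrite eq_lshift.
rewrite [in X in _ + X](eq_bigr (fun e =>
  Phi (graft (troot (ltree_of A)) (ltree_of B)) (rshift _ e))) => [|e _]; last by rewrite eq_rlshift.
rewrite -big_mkcond (bigD1 (troot (ltree_of B))) //= HPsi addrCA; congr (_ + (_ + _)).
  (* Edges of the graft are the joining edge, already split off, those of A and those of B. For A,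
     the induction hypothesis is applied to [Phi] with B grafted back at the root. *)
  rewrite (IHA (fun s e => Phi (graft (troot s) (ltree_of B)) (lshift _ e))
    (fun s s' => Psi (graft (troot s) (ltree_of B)) s')) //.
    move=> s s' f e Hf; have fr := is_iso_troot Hf.
    have idr : @is_iso (ltree_of B) (ltree_of B) id by split; first by exists id.
    by rewrite (HPhi _ _ _ _ (graft_fun_iso Hf idr fr)) graft_funl.
  move=> s w s'; rewrite -(HPsi (graft (troot s) (ltree_of B)) (lshift _ w)).
  rewrite troot_graft (HPhi _ _ _ _ (graft_swapl_iso _ _ _ _)) /graft_swapl.
  by rewrite split_lshift split_rshift.
rewrite (IHB (fun s e => Phi (graft (troot (ltree_of A)) s) (rshift _ e))
    (fun s s' => Psi (graft (troot (ltree_of A)) s) s')) //.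
  move=> s s' f e Hf.
  have idr : @is_iso (ltree_of A) (ltree_of A) id by split; first by exists id.
  by rewrite (HPhi _ _ _ _ (graft_fun_iso idr Hf (erefl (troot (ltree_of A))))) graft_funr.
move=> s w s'; rewrite -(HPsi (graft (troot (ltree_of A)) s) (rshift _ w)).
rewrite (HPhi _ _ _ _ (graft_assoc_iso _ _ _)) /graft_assoc.
by rewrite !split_rshift.
Qed.

(** * Counting isomorphisms *)

Definition isos t t' := [pred f : {ffun vertex t -> vertex t'} | `[< is_iso f >]].

Lemma isosP t t' (f : {ffun vertex t -> vertex t'}) : reflect (is_iso f) (f \in isos t t').
Proof. by rewrite inE; apply: (iffP idP) => [/asboolP|/asboolP]. Qed.

(** Composing with fixed isomorphisms on both sides is injective; by symmetry one inequality is
    enough. *)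
Lemma card_isos t t' s s' : tree_iso t s -> tree_iso t' s' ->
  #|isos t t'| = #|isos s s'|.
Proof.
suff H t1 t1' s1 s1' : tree_iso t1 s1 -> tree_iso t1' s1' ->
    (#|isos t1 t1'| <= #|isos s1 s1'|)%N.
  by move=> H1 H2; apply/eqP; rewrite eqn_leq !H // tree_iso_sym.
move=> /tree_iso_is_iso[f Hf] /tree_iso_is_iso[g Hg].
have [f' [Hf' fK f'K]] := is_iso_inv Hf.
pose h (k : {ffun vertex t1 -> vertex t1'}) : {ffun vertex s1 -> vertex s1'} :=
  [ffun x => g (k (f' x))].
rewrite -(@card_in_imset _ _ h).
  apply: subset_leq_card; apply/fintype.subsetP => _ /imsetP[k /isosP Hk ->].
  apply/isosP; have -> : h k = g \o k \o f' :> (_ -> _) by apply/funext => x; rewrite ffunE.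
  exact: is_iso_comp (is_iso_comp Hg Hk) Hf'.
move=> k k' _ _ /ffunP E; apply/ffunP => x; have := E (f x).
by rewrite !ffunE fK; apply: (bij_inj Hg.1).
Qed.

Lemma card_isos_repr T : #|isos (repr T) (repr T)| = aut T.
Proof.
rewrite /aut -(card_imset (f := fun s : {perm vertex (repr T)} => [ffun x => s x])).
  apply: eq_card => f; apply/isosP/imsetP => [[bf Hf]|[s]].
    exists (perm (bij_inj bf)); last by apply/ffunP => x; rewrite ffunE permE.
    by rewrite inE; apply/forallP => v; rewrite !permE Hf.
  rewrite inE => /forallP Hs ->; split.
    apply: injF_bij => x y; rewrite !ffunE; exact: perm_inj.
  by move=> v; rewrite !ffunE; apply/eqP.
by move=> s s' /ffunP E; apply/permP => x; have := E x; rewrite !ffunE.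
Qed.

Lemma card_isosE t t' :
  #|isos t t'| = ((\pi_rtree t == \pi_rtree t') * aut (\pi_rtree t'))%N.
Proof.
rewrite iso_pi; case: (boolP (tree_iso t t')) => [H|/negP H].
  rewrite mul1n -card_isos_repr; apply: card_isos; last exact: iso_repr.
  by apply: tree_iso_trans H _; apply: iso_repr.
by apply: eq_card0 => f; apply/negP => /isosP /is_iso_tree_iso.
Qed.

Lemma aut_gt0 T : (0 < aut T)%N.
Proof.
apply/card_gt0P; exists (1%g : {perm _}); rewrite inE; apply/forallP => v.
by rewrite !perm1.
Qed.

(** An isomorphism that preserves the grafting edge preserves the two sides of it: the branch by
    induction on the distance to its root, the trunk by applying this to the inverse. *)
Lemma graft_iso_split t v t' s w s' (f : vertex (@graft t v t') -> vertex (@graft s w s')) :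
  is_iso f -> f (rshift _ (troot t')) = rshift _ (troot s') ->
  exists (g : vertex t -> vertex s) (h : vertex t' -> vertex s'),
    [/\ is_iso g, is_iso h, g v = w & f =1 @graft_fun t v t' s w s' g h].
Proof.
have R u x u' z y z' (k : vertex (@graft u x u') -> vertex (@graft z y z')) : is_iso k ->
    k (rshift _ (troot u')) = rshift _ (troot z') -> forall b, exists c, k (rshift _ b) = rshift _ c.
  move=> [_ Hk] kr b; have [n] := iter_parent_troot b.
  elim: n b => [|n IH] b; first by move=> /= ->; exists (troot z').
  rewrite iterSr; case: (parent u' b =P b) => [|/eqP Hb].
    by move=> /eqP; rewrite parent_fix => /eqP -> _; exists (troot z').
  move=> /IH[c]; have := Hk (rshift _ b); rewrite graft_parentr (negPf Hb) => -> .
  case: (split_ordP (k (rshift _ b))) => j ->; last by exists j.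
  by rewrite graft_parentl => /eqP; rewrite eq_lrshift.
have L u x u' z y z' (k : vertex (@graft u x u') -> vertex (@graft z y z')) : is_iso k ->
    k (rshift _ (troot u')) = rshift _ (troot z') -> forall a, exists c, k (lshift _ a) = lshift _ c.
  move=> Hk kr a; have [k' [Hk' kK k'K]] := is_iso_inv Hk.
  have kr' : k' (rshift _ (troot z')) = rshift _ (troot u') by rewrite -kr kK.
  case: (split_ordP (k (lshift _ a))) => j E; first by exists j.
  have [c Hc] := R _ _ _ _ _ _ _ Hk' kr' j.
  by have := kK (lshift _ a); rewrite E Hc => /eqP; rewrite eq_rlshift.
move=> Hf fr; have [f' [Hf' fK f'K]] := is_iso_inv Hf.
have fr' : f' (rshift _ (troot s')) = rshift _ (troot t') by rewrite -fr fK.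
have [g Hg] := choice (L _ _ _ _ _ _ _ Hf fr).
have [h Hh] := choice (R _ _ _ _ _ _ _ Hf fr).
have [g' Hg'] := choice (L _ _ _ _ _ _ _ Hf' fr').
have [h' Hh'] := choice (R _ _ _ _ _ _ _ Hf' fr').
exists g, h; split.
- split.
    exists g' => x; first by apply: (@lshift_inj _ (nverts t')); rewrite -Hg' -Hg fK.
    by apply: (@lshift_inj _ (nverts s')); rewrite -Hg -Hg' f'K.
  move=> x; apply: (@lshift_inj _ (nverts s')); rewrite -Hg -graft_parentl Hf.2.
  by rewrite Hg graft_parentl.
- have hr : h (troot t') = troot s' by apply: (@rshift_inj (nverts s)); rewrite -Hh.
  have bh : cancel h h' by move=> x; apply: (@rshift_inj (nverts t)); rewrite -Hh' -Hh fK.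
  split.
    by exists h' => // x; apply: (@rshift_inj (nverts s)); rewrite -Hh -Hh' f'K.
  move=> x; case: (eqVneq x (troot t')) => [->|Hx]; first by rewrite parent_troot hr parent_troot.
  apply: (@rshift_inj (nverts s)); rewrite -Hh.
  have := Hf.2 (rshift _ x); rewrite graft_parentr parent_fix (negPf Hx) => ->.
  by rewrite Hh graft_parentr parent_fix -hr (can_eq bh) (negPf Hx).
- apply: (@lshift_inj _ (nverts s')); rewrite -Hg.
  have := Hf.2 (rshift _ (troot t')); rewrite graft_parentr parent_troot eqxx => ->.
  by rewrite fr graft_parentr parent_troot eqxx.
by move=> i; case: (split_ordP i) => j ->; rewrite ?graft_funl ?graft_funr ?Hg ?Hh.
Qed.

Definition edge_isos t t' s (e : vertex s) (v : vertex t) :=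
  [pred f : {ffun vertex (graft v t') -> vertex s} |
    (f \in isos (graft v t') s) && (f (rshift _ (troot t')) == e)].

(** By [graft_iso_split] such an isomorphism is a pair (g, h) with g v = w; each pair occurs for
    exactly one v, the preimage of w. *)
Lemma card_edge_isos_graft t t' s w s' :
  (\sum_(v : vertex t) #|@edge_isos t t' (graft w s') (rshift (nverts s) (troot s')) v| =
   #|isos t s| * #|isos t' s'|)%N.
Proof.
pose D := predX (isos t s) (isos t' s').
have H v : #|@edge_isos t t' (graft w s') (rshift (nverts s) (troot s')) v| =
    (\sum_(p | p \in D) (p.1 v == w))%N.
  pose F (p : {ffun vertex t -> vertex s} * {ffun vertex t' -> vertex s'}) :
      {ffun vertex (graft v t') -> vertex (graft w s')} :=
    [ffun i => @graft_fun t v t' s w s' p.1 p.2 i].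
  transitivity (\sum_(p | (p \in D) && (p.1 v == w)) 1)%N; last first.
    by rewrite big_mkcondr; apply: eq_bigr => p _; case: eqP.
  rewrite sum1_card -(card_imset (f := F)).
    apply: eq_card => f; apply/andP/imsetP => [[/isosP Hf /eqP fr]|[[g h]]].
      have [g [h [Hg Hh gv E]]] := graft_iso_split Hf fr.
      exists ([ffun x => g x], [ffun x => h x]).
        apply/andP; split; last by rewrite ffunE gv.
        apply/andP; split; apply/isosP.
          by rewrite [X in is_iso X](_ : _ = g) //; apply/funext => x; rewrite ffunE.
        by rewrite [X in is_iso X](_ : _ = h) //; apply/funext => x; rewrite ffunE.
      apply/ffunP => i; rewrite E ffunE; case: (split_ordP i) => j ->;
      by rewrite ?graft_funl ?graft_funr ffunE.
    move=> /andP[/andP[/isosP Hg /isosP Hh] /eqP gv] ->; split.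
      apply/isosP; rewrite [X in is_iso X](_ : _ = @graft_fun t v t' s w s' g h).
        exact: graft_fun_iso.
      by apply/funext => x; rewrite ffunE.
    by rewrite ffunE graft_funr (is_iso_troot Hh).
  move=> [g h] [g' h'] /ffunP E; congr (_, _); apply/ffunP => x.
    have := E (lshift _ x); rewrite !ffunE !graft_funl; exact: lshift_inj.
  have := E (rshift _ x); rewrite !ffunE !graft_funr; exact: rshift_inj.
rewrite (eq_bigr _ (fun v _ => H v)) exchange_big /= -cardX -sum1_card.
apply: eq_bigr => -[g h] /andP[/isosP [[g' gK g'K] _] _] /=.
rewrite (bigD1 (g' w)) //= g'K eqxx big1 // => v /negP Hv.
by case: eqP => // E; case: Hv; rewrite -E gK.
Qed.

Lemma card_edge_isos_iso t t' s s' (f : vertex s -> vertex s') e (v : vertex t) :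
  is_iso f -> #|edge_isos t' e v| = #|edge_isos t' (f e) v|.
Proof.
suff H s1 s1' (g : vertex s1 -> vertex s1') e1 : is_iso g ->
    (#|edge_isos t' e1 v| <= #|edge_isos t' (g e1) v|)%N.
  move=> Hf; apply/eqP; rewrite eqn_leq H //=.
  have [f' [Hf' fK _]] := is_iso_inv Hf; have := H _ _ _ (f e) Hf'.
  by rewrite fK.
move=> Hg; pose h (k : {ffun vertex (graft v t') -> vertex s1}) :
  {ffun vertex (graft v t') -> vertex s1'} := [ffun x => g (k x)].
rewrite -(@card_in_imset _ _ h).
  apply: subset_leq_card; apply/fintype.subsetP => _ /imsetP[k /andP[/isosP Hk /eqP ke] ->].
  apply/andP; split; last by rewrite ffunE ke.
  apply/isosP; have -> : h k = g \o k :> (_ -> _) by apply/funext => x; rewrite ffunE.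
  exact: is_iso_comp Hg Hk.
move=> k k' _ _ /ffunP E; apply/ffunP => x; have := E x.
by rewrite !ffunE; apply: (bij_inj Hg.1).
Qed.

(** Isomorphisms are sorted by the edge of P to which they send the grafting edge, and [sum_cuts]
    turns the edges into cuts. *)
Lemma card_isos_graft t t' P :
  (\sum_(v : vertex t) #|isos (graft v t') (ltree_of P)| =
   \sum_(c <- cuts P) #|isos t (ltree_of c.1)| * #|isos t' (ltree_of c.2)|)%N.
Proof.
rewrite -(@sum_cuts _ (fun s e => \sum_(v : vertex t) #|edge_isos t' e v|)
  (fun s s' => #|isos t s| * #|isos t' s'|))%N; first last.
- exact: card_edge_isos_graft.
- by move=> s s' f e Hf; apply: eq_bigr => v _; apply: card_edge_isos_iso.
rewrite exchange_big; apply: eq_bigr => v _ /=.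
rewrite -sum1_card (partition_big (fun f : {ffun _ -> _} => f (rshift (nverts t) (troot t')))
  (fun e => e != troot (ltree_of P))) => [|f /isosP Hf].
  by apply: eq_bigr => e _; rewrite -sum1_card; apply: eq_bigl => f.
rewrite -(is_iso_troot Hf) (inj_eq (bij_inj Hf.1)) troot_graft.
by rewrite eq_rlshift.
Qed.

(** Both sides count the isomorphisms from all graftings of T' on T to P: on the left each vertex v
    contributes aut(P) or 0, on the right they are sorted by edges of P. *)
Lemma graft_count_aut T T' P :
  (graft_count T T' (\pi_rtree (ltree_of P)) * aut (\pi_rtree (ltree_of P)) =
   aut T * aut T' *
   \sum_(c <- cuts P) ((\pi_rtree (ltree_of c.1) == T) && (\pi_rtree (ltree_of c.2) == T')))%N.
Proof.
rewrite -[T in LHS]reprK -[T' in LHS]reprK graft_countE big_distrl /=.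
rewrite (eq_bigr (fun v => #|isos (graft v (repr T')) (ltree_of P)|)) => [|v _]; last by rewrite card_isosE.
rewrite card_isos_graft big_distrr; apply: eq_bigr => c _ /=.
rewrite !card_isosE !reprK ![_ == \pi_rtree _]eq_sym.
by case: eqP => [->|_]; case: eqP => [->|_]; rewrite ?(mul1n, mul0n, muln1, muln0).
Qed.

(* The coordinates of x in the basis T / aut T, which is dual to the basis of *)
(* the Connes-Kreimer coalgebra, pulled back to planar trees.                 *)
Definition pcoord (K : fieldType) (x : PLhat K) (P : ptree) : K :=
  (aut (\pi_rtree (ltree_of P)))%:R * x (\pi_rtree (ltree_of P)).

Lemma bsize_cuts P c : c \in cuts P -> (bsize c.1 + bsize c.2 = bsize P)%N.
Proof.
elim: P c => // A IHA B IHB c /=.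
rewrite inE mem_cat => /or3P[/eqP -> //|/mapP[d /IHA <- ->]|/mapP[d /IHB <- ->]] /=.
  by rewrite addnAC.
by rewrite addnA.
Qed.

Lemma treesize_ltree_of P : treesize (\pi_rtree (ltree_of P)) = bsize P.
Proof. by rewrite treesize_pi nverts_ltree_of. Qed.

(** The factors [aut] absorb the multiplicities of [graft_count], and each cut selects a single pair
    of trees in the double sum. *)
Lemma pcoord_prelie (K : fieldType) (x y : PLhat K) P :
  pcoord (prelie x y) P = cutprod (pcoord x) (pcoord y) P.
Proof.
rewrite {1}/pcoord; set S := \pi_rtree _; set N := bsize P.
have HN : (treesize S <= N)%N by rewrite treesize_ltree_of.
rewrite (prelieE _ _ HN) mulr_sumr.
transitivity (\sum_(T <- trees_le N) \sum_(T' <- trees_le N) \sum_(c <- cuts P)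
  ((\pi_rtree (ltree_of c.1) == T) && (\pi_rtree (ltree_of c.2) == T'))%:R *
  ((aut T)%:R * x T * ((aut T')%:R * y T'))).
  apply: eq_bigr => T _; rewrite mulr_sumr; apply: eq_bigr => T' _.
  rewrite mulrCA -natrM mulnC graft_count_aut !natrM natr_sum.
  rewrite -mulr_suml; ring.
under eq_bigr do rewrite exchange_big /=.
rewrite exchange_big; apply: eq_big_seq => c /bsize_cuts Hc /=.
have H1 : \pi_rtree (ltree_of c.1) \in trees_le N.
  by apply: mem_trees_le; rewrite treesize_ltree_of /N -Hc leq_addr.
have H2 : \pi_rtree (ltree_of c.2) \in trees_le N.
  by apply: mem_trees_le; rewrite treesize_ltree_of /N -Hc leq_addl.
rewrite (bigD1_seq _ H1) ?trees_le_uniq //= [X in _ + X]big1 => [|T /negPf HT]; last first.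
  by rewrite big1 // => T' _; rewrite eq_sym HT mul0r.
rewrite addr0 (bigD1_seq _ H2) ?trees_le_uniq //= big1 => [|T' /negPf HT]; last first.
  by rewrite [_ == T']eq_sym HT andbF mul0r.
by rewrite !eqxx mul1r addr0.
Qed.

(** * Planar representatives of rooted trees *)

Lemma ex_leaf t : (1 < nverts t)%N -> exists l : vertex t, forall v, parent t v != l.
Proof.
move=> Ht; apply: contrapT => /forallNP H.
(* Without a leaf the parent map is onto, hence injective by finiteness; then the only vertex that
   reaches the root is the root. *)
have sur l : exists v, parent t v = l.
  by have /existsNP[v /negP/negPn/eqP Hv] := H l; exists v.
have [g Hg] := choice sur.
have inj : injective (parent t).
  have [g' gK g'K] : bijective g by apply: injF_bij; apply: can_inj Hg.
  by apply: (@can_inj _ _ _ g) => v; rewrite -[v in LHS]g'K Hg g'K.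
have allr v : v = troot t.
  have [k Hk] := iter_parent_troot v; elim: k Hk => //= k IH.
  by rewrite -[X in _ = X]parent_troot => /inj /IH.
have : (#|[set: vertex t]| <= 1)%N.
  by apply/card_le1_eqP => u v _ _; rewrite (allr u) (allr v).
by rewrite cardsT card_ord leqNgt Ht.
Qed.

Lemma remove_leaf t (l : vertex t) : (1 < nverts t)%N -> (forall v, parent t v != l) ->
  exists t' (w : vertex t'), nverts t = (nverts t').+1 /\ tree_iso (graft w dot_ltree) t.
Proof.
have := parent_troot t; have := @iter_parent_troot t; move: (troot t).
case: t l => -[[|n] p] Hp l; first by case: l.
rewrite /parent /= => r Hr pr Hn Hl.
(* The default of [odflt] is never reached, since [l] is nobody's parent. *)
pose q : {ffun 'I_n -> 'I_n} := [ffun i => odflt i (unlift l (p (lift l i)))].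
have lq i : lift l (q i) = p (lift l i).
  rewrite ffunE; case: (unliftP l (p (lift l i))) => [j -> //|E].
  by have := Hl (lift l i); rewrite E eqxx.
case: (unliftP l r) => [r0 Er|Er]; last by have := Hl r; rewrite pr Er eqxx.
have Hq : is_rooted_tree (existT (fun n => {ffun 'I_n -> 'I_n}) n q).
  apply: (@is_rooted_treeI (existT (fun n => {ffun 'I_n -> 'I_n}) n q) r0) => /= [|v].
    by apply: (@lift_inj _ l); rewrite lq -Er.
  have [k Hk] := Hr (lift l v); exists k; apply: (@lift_inj _ l); rewrite -Er -Hk.
  by elim: k {Hk} => //= k <-; rewrite lq.
pose t' : ltree := exist is_rooted_tree _ Hq.
case: (unliftP l (p l)) => [w Ew|Ew]; last by have := Hl l; rewrite Ew eqxx.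
pose F (i : 'I_(n + 1)) := match fintype.split i with inl a => lift l a | inr _ => l end.
have Fl a : F (lshift 1 a) = lift l a by rewrite /F split_lshift.
have Fr b : F (rshift n b) = l by rewrite /F split_rshift.
exists t', (w : vertex t'); split=> //; apply/asboolP; exists F.
  exists (fun j => if unlift l j is Some a then lshift 1 a else rshift n ord0) => i.
    case: (split_ordP i) => j ->; first by rewrite Fl liftK.
    by rewrite Fr unlift_none [j]ord1.
  by case: (unliftP l i) => [j ->|->]; rewrite ?Fl ?Fr.
move=> i; case: (split_ordP i) => j ->.
  apply: etrans (congr1 F (@graft_parentl t' w dot_ltree j)) _.
  exact: etrans (Fl _) (etrans (lq j) (esym (congr1 p (Fl j)))).
apply: etrans (congr1 F (@graft_parentr t' w dot_ltree j)) _.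
rewrite [j]ord1 [X in X == _]ord1 eqxx.
exact: etrans (Fl _) (etrans (esym Ew) (esym (congr1 p (Fr _)))).
Qed.

(** Exchanging or reassociating the grafts moves the new branch down into A or B, until it is
    attached to a single vertex. *)
Lemma ltree_of_graft P Q (v : vertex (ltree_of P)) :
  exists P', tree_iso (graft v (ltree_of Q)) (ltree_of P').
Proof.
have idi s : @is_iso s s id by split=> //; exists id.
elim: P v => [|A IHA B IHB] v.
  exists (Gr Single Q); have -> : v = troot dot_ltree by rewrite [LHS]ord1 [RHS]ord1.
  exact: tree_iso_refl.
case: (split_ordP v) => [a|b] ->.
  have [A' /tree_iso_is_iso[f Hf]] := IHA a; exists (Gr A' B).
  apply: tree_iso_trans (is_iso_tree_iso (graft_swapl_iso _ _ _ _)) _.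
  apply: (is_iso_tree_iso (graft_fun_iso Hf (idi _) _)).
  by rewrite -troot_graft (is_iso_troot Hf).
have [B' /tree_iso_is_iso[f Hf]] := IHB b; exists (Gr A B').
rewrite tree_iso_sym.
apply: tree_iso_trans (is_iso_tree_iso (graft_assoc_iso _ _ _)).
rewrite tree_iso_sym.
exact: (is_iso_tree_iso (graft_fun_iso (idi (ltree_of A)) Hf erefl)).
Qed.

(** Induction on the number of vertices: remove a leaf, take a planar form of the rest and graft the
    leaf back. *)
Lemma ltree_of_surj (S : rtree) : exists P, S = \pi_rtree (ltree_of P).
Proof.
rewrite -(reprK S); move: (repr S) => t {S}.
suff [P HP] : exists P, tree_iso t (ltree_of P) by exists P; apply/eqP; rewrite iso_pi.
elim: {t}(nverts t) {-2}t (leqnn (nverts t)) => [|n IH] t Ht.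
  by have := leq_ltn_trans (leq0n _) (ltn_ord (troot t)); rewrite ltnNge Ht.
have [Ht1|Ht1] := leqP (nverts t) 1.
  have E (u v : vertex t) : u = v.
    apply: val_inj => /=; move: (leq_trans (ltn_ord u) Ht1) (leq_trans (ltn_ord v) Ht1).
    by rewrite !ltnS !leqn0 => /eqP -> /eqP ->.
  exists Single; apply: (@is_iso_tree_iso _ _ (fun=> troot dot_ltree)); split; last first.
    by move=> v; rewrite parent_troot.
  by exists (fun=> troot t) => v; [exact: E | rewrite [LHS]ord1 [RHS]ord1].
have [l Hl] := ex_leaf Ht1; have [t' [w [E Hw]]] := remove_leaf Ht1 Hl.
have [|P /tree_iso_is_iso[f Hf]] := IH t'; first by rewrite -ltnS -E.
have [P' HP'] := @ltree_of_graft P Single (f w); exists P'.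
rewrite tree_iso_sym; apply: tree_iso_trans Hw; rewrite tree_iso_sym.
apply: tree_iso_trans HP'; apply: (is_iso_tree_iso (graft_fun_iso Hf _ erefl)).
by split; [exists id | ].
Qed.

(** * The action of power series *)

Section UactSeries.
Variable K : fieldType.
Implicit Types (x y : PLhat K) (a b : nat -> K).

Lemma tens_actX x y n :
  tens_act x (tens_elt y ^+ n) = iter n (fun z => prelie z y) x.
Proof.
elim: n => [|n IH]; first exact: tens_act_word.
by rewrite exprSr tens_actM IH tens_act_elt.
Qed.

(** Words of length n contribute only to the n-th power of y, and words of degree above N act as
    zero on S. *)
Lemma Uact_series a x y S N : (treesize S <= N)%N ->
  Uact x (Useries a (PL_to_U y)) S =
  \sum_(n < N.+1) a n * iter n (fun z => prelie z y) x S.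
Proof.
move=> HS; rewrite Useries_elt Uact_proj (tens_actE _ _ HS).
under [RHS]eq_bigr do rewrite -tens_actX (tens_actE _ _ HS) mulr_sumr.
rewrite exchange_big; apply: eq_big_seq => w; rewrite mem_words_le => Hw /=.
have Hs : (size w < N.+1)%N by rewrite ltnS (leq_trans (size_wdeg w)).
rewrite (bigD1 (Ordinal Hs)) //= [X in _ + X]big1 => [|n /negPf Hn].
  by rewrite addr0 tens_eltX eqxx mul1r mulrA.
rewrite tens_eltX; case: eqP => [E|_]; last by rewrite !mul0r mulr0.
by case/negP: (negbT Hn); apply/eqP/val_inj.
Qed.

(** Series in the same element multiply by the Cauchy product, because the product of the
    coefficients of y along a word splits wherever the word is cut. *)
Lemma UseriesM a b y : Useries a (PL_to_U y) * Useries b (PL_to_U y) =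
  Useries (fun n => \sum_(k < n.+1) a k * b (n - k)%N) (PL_to_U y).
Proof.
rewrite !Useries_elt -[_ * _]UprojM; congr Uproj; apply: tensP => w.
rewrite tensM mulr_suml; apply: eq_bigr => k _.
have Hk : (k <= size w)%N by rewrite -ltnS.
have -> : \prod_(T <- w) y T = \prod_(T <- take k w) y T * \prod_(T <- drop k w) y T.
  by rewrite -big_cat cat_take_drop.
by rewrite size_takel // size_drop mulrACA.
Qed.

Lemma Useries1 y : Useries (fun n => (n == 0%N)%:R) (PL_to_U y) = 1.
Proof.
rewrite Useries_elt [RHS]/(Uproj 1); congr Uproj; apply: tensP => -[|T w].
  by rewrite big_nil mulr1.
by rewrite mul0r.
Qed.

(** Acting on the equation of [Omega] with (exp y - 1)/y cancels the series y/(exp y - 1); this is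
    [bern_coefP]. *)
Lemma bullet_Omega y : is_Omega y ->
  bullet K = Uact y (Useries (fun n => (n.+1)`!%:R^-1) (PL_to_U y)).
Proof.
move=> Hy; set u := Useries _ _.
have <- : Uact (Uact (bullet K) (Ubern y)) u = Uact y u by congr Uact.
rewrite /u /Ubern -UactM UseriesM.
rewrite [X in Useries X](_ : _ = (fun n => (n == 0%N)%:R)) ?Useries1 ?Uact1 //.
apply/funext => n; rewrite -(bern_coefP K); apply: eq_bigr => k _.
by rewrite subSn // -ltnS.
Qed.

Lemma pcoord_Uact_series a x y P N : (bsize P <= N)%N ->
  pcoord (Uact x (Useries a (PL_to_U y))) P =
  \sum_(n < N.+1) a n * iter n (fun z => cutprod z (pcoord y)) (pcoord x) P.
Proof.
move=> HN; rewrite {1}/pcoord (@Uact_series _ _ _ _ N) ?treesize_ltree_of // mulr_sumr.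
apply: eq_bigr => n _; rewrite mulrCA; congr (_ * _).
suff -> : iter n (fun z => cutprod z (pcoord y)) (pcoord x) =
  pcoord (iter n (fun z => prelie z y) x) by [].
by elim: (nat_of_ord n) => //= m ->; apply/funext => Q; rewrite pcoord_prelie.
Qed.

Lemma pcoord_bullet P : pcoord (bullet K) P = (is_single P)%:R.
Proof.
rewrite /pcoord /bullet /tree_elt; case: P => [|A B] /=.
  rewrite eqxx mulr1; congr _%:R; apply/eqP; rewrite eqn_leq aut_gt0 andbT.
  apply/card_le1_eqP => s s' _ _; apply/permP => v.
  have E (u w : vertex (repr (\pi_rtree dot_ltree))) : u = w.
    by apply/val_inj; move: u w; rewrite -/(treesize _) treesize_pi => u w; rewrite [u]ord1 [w]ord1.
  exact: E.
case: eqP => [E|_]; last by rewrite mulr0.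
have := treesize_ltree_of (Gr A B); rewrite /= E treesize_pi => H.
by have := leq_add (bsize_gt0 A) (bsize_gt0 B); rewrite -H.
Qed.

End UactSeries.

Definition Omega_infty : PLhat rat := fun T => (-1) ^+ (treesize T).-1 / (aut T)%:R.

(** In [pcoord] the series is the sign (-1)^(#T-1), and [bullet_Omega] is the hypothesis on [beta]
    in [exp_cutprod], so only one-vertex branches are cut and [admcut_sign] applies. *)
Lemma Uact_Omega_infty y : is_Omega y -> Uact Omega_infty (Uexp y) = bullet rat.
Proof.
move=> Hy; apply: PLhatP => S; have [P ->] := ltree_of_surj S.
apply: (@mulfI _ (aut (\pi_rtree (ltree_of P)))%:R).
  by rewrite pnatr_eq0 -lt0n aut_gt0.
rewrite -[LHS]/(pcoord _ P) -[RHS]/(pcoord _ P) /Uexp.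
rewrite (pcoord_Uact_series _ _ _ (leqnn _)).
rewrite (@exp_cutprod _ _ _ (pcoord (bullet rat)) (bsize P)) // => [|Q n HQ]; last first.
  by rewrite {1}(bullet_Omega Hy) (pcoord_Uact_series _ _ _ HQ).
rewrite pcoord_bullet -admcut_sign; apply: eq_admcut => Q; first exact: pcoord_bullet.
rewrite /pcoord /Omega_infty treesize_ltree_of mulrC divfK //.
by rewrite pnatr_eq0 -lt0n aut_gt0.
Qed.

(** * Limits at infinity of rational functions *)

Lemma tofrac_eq0F (b : {poly rat}) : (@FracField.tofrac _ b == 0) = (b == 0).
Proof. by rewrite -(rmorph0 (@FracField.tofrac {poly rat})) tofrac_eq. Qed.

(** Roots are factored out one by one. Far from them, fractions can be added pointwise in spite of
    the convention 1/0 = 0. *)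
Lemma poly_neq0_far (b : {poly rat}) : b != 0 ->
  exists M : rat, forall x, M < `|x| -> b.[x] != 0.
Proof.
elim: {b}(size b) {-2}b (leqnn (size b)) => [|n IH] b.
  by rewrite leqn0 size_poly_eq0 => /eqP ->; rewrite eqxx.
move=> Hs b0; have [[r rb]|nr] := pselect (exists r, poly.root b r); last first.
  by exists 0 => x _; apply/negP => H; apply: nr; exists x.
have [c Ec] := factor_theorem _ _ rb.
have c0 : c != 0 by apply: contraNneq b0 => E; rewrite Ec E mul0r.
have [|M HM] := IH c _ c0.
  by move: Hs; rewrite Ec size_Mmonic ?monicXsubC // size_XsubC addn2.
exists (Num.max M `|r|) => x; rewrite gt_max => /andP[/HM Hc Hr].
rewrite Ec hornerM mulf_neq0 // hornerXsubC subr_eq0.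
by apply: contraTneq Hr => ->; rewrite ltxx.
Qed.

Lemma lim_inftyD f g l m : lim_infty f l -> lim_infty g m -> lim_infty (f + g) (l + m).
Proof.
move=> [a [b [b0 -> Hf]]] [c [d [d0 -> Hg]]].
exists (a * d + c * b), (b * d); split; first exact: mulf_neq0.
  by rewrite addf_div ?tofrac_eq0F // rmorphD /= !rmorphM.
move=> e e0; have [M HM] := Hf (e / 2) ltac:(lra).
have [M' HM'] := Hg (e / 2) ltac:(lra).
have [Mb HMb] := poly_neq0_far b0; have [Md HMd] := poly_neq0_far d0.
exists (Num.max (Num.max M M') (Num.max Mb Md)) => x.
rewrite !gt_max => /andP[/andP[/HM h1 /HM' h2] /andP[/HMb h3 /HMd h4]].
rewrite hornerD !hornerM.
have -> : (a.[x] * d.[x] + c.[x] * b.[x]) / (b.[x] * d.[x]) - (l + m) =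
  (a.[x] / b.[x] - l) + (c.[x] / d.[x] - m) by field; exact/andP.
by apply: le_lt_trans (ler_normD _ _) _; lra.
Qed.

Lemma lim_inftyM f g l m : lim_infty f l -> lim_infty g m -> lim_infty (f * g) (l * m).
Proof.
move=> [a [b [b0 -> Hf]]] [c [d [d0 -> Hg]]].
exists (a * c), (b * d); split; first exact: mulf_neq0.
  by rewrite mulf_div !rmorphM.
move=> e e0.
(* The error is uv + lv + mu; with |u|, |v| < e' <= 1 it is below e' D. *)
pose D := 1 + `|l| + `|m|; have D0 : 0 < D by rewrite /D; have := normr_ge0 l; have := normr_ge0 m; lra.
pose e' := Num.min 1 (e / D).
have e'0 : 0 < e' by rewrite lt_min ltr01 divr_gt0.
have e'1 : e' <= 1 by rewrite ge_min lexx.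
have e'D : e' * D <= e by rewrite -ler_pdivlMr // ge_min lexx orbT.
have [M HM] := Hf e' e'0; have [M' HM'] := Hg e' e'0.
exists (Num.max M M') => x.
rewrite !gt_max => /andP[/HM h1 /HM' h2]; rewrite !hornerM.
set u := a.[x] / b.[x] - l in h1 *; set v := c.[x] / d.[x] - m in h2 *.
have -> : a.[x] * c.[x] / (b.[x] * d.[x]) - l * m = u * v + l * v + m * u.
  by rewrite /u /v invfM; ring.
apply: le_lt_trans (ler_normD _ _) _.
apply: le_lt_trans (lerD (ler_normD _ _) (lexx _)) _; rewrite !normrM.
apply: lt_le_trans e'D; rewrite /D !mulrDr mulr1 ![e' * _]mulrC.
apply: ltr_leD; last by rewrite ler_wpM2l // ltW.
apply: ltr_leD; last by rewrite ler_wpM2l // ltW.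
apply: le_lt_trans h1; rewrite -[leRHS]mulr1; apply: ler_wpM2l => //.
exact: ltW (lt_le_trans h2 e'1).
Qed.

Lemma lim_infty_const c : lim_infty (Qq_const c) c.
Proof.
exists c%:P, 1; split; rewrite ?oner_eq0 //; first by rewrite rmorph1 divr1.
by move=> e e0; exists 0 => x _; rewrite hornerC hornerC divr1 subrr normr0.
Qed.

Lemma Qq_const_nat n : Qq_const n%:R = n%:R.
Proof. by rewrite /Qq_const polyC_natr rmorph_nat. Qed.

Lemma lim_infty_nat n : lim_infty n%:R n%:R.
Proof. by rewrite -{1}Qq_const_nat; apply: lim_infty_const. Qed.

Lemma lim_infty_sum I (r : seq I) (P : pred I) (f : I -> Qq) l :
  (forall i, P i -> lim_infty (f i) (l i)) ->
  lim_infty (\sum_(i <- r | P i) f i) (\sum_(i <- r | P i) l i).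
Proof.
move=> H; elim/big_rec2: _ => [|i x y Pi Hxy]; first exact: (lim_infty_nat 0).
by apply: lim_inftyD => //; apply: H.
Qed.

Lemma lim_infty_prod I (r : seq I) (P : pred I) (f : I -> Qq) l :
  (forall i, P i -> lim_infty (f i) (l i)) ->
  lim_infty (\prod_(i <- r | P i) f i) (\prod_(i <- r | P i) l i).
Proof.
move=> H; elim/big_rec2: _ => [|i x y Pi Hxy]; first exact: (lim_infty_nat 1).
by apply: lim_inftyM => //; apply: H.
Qed.

Lemma lim_inftyN f l : lim_infty f l -> lim_infty (- f) (- l).
Proof.
move=> [a [b [b0 -> Hf]]]; exists (- a), b; split; rewrite ?rmorphN ?mulNr //.
move=> e /Hf[M HM]; exists M => x /HM.
by rewrite hornerN mulNr -opprD normrN.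
Qed.

Lemma lim_inftyB f g l m : lim_infty f l -> lim_infty g m -> lim_infty (f - g) (l - m).
Proof. by move=> Hf Hg; apply: lim_inftyD => //; apply: lim_inftyN. Qed.

Lemma lim_infty_invX n : (0 < n)%N -> lim_infty ((qvar ^+ n - 1)^-1) 0.
Proof.
move=> Hn; exists 1, ('X^n - 1); split.
- by rewrite -size_poly_eq0 size_XnsubC.
- by rewrite rmorph1 div1r rmorphB rmorph1 rmorphXn.
(* For |x| >= 1, |x^n - 1| >= |x| - 1, which has to exceed 1/e. *)
move=> e e0; exists (1 + e^-1) => x Hx.
have ie0 : 0 < e^-1 by rewrite invr_gt0.
have Hx1 : 1 <= `|x| by apply: ltW; apply: le_lt_trans Hx; lra.
rewrite hornerD hornerN hornerXn !hornerC div1r subr0.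
have H : e^-1 < `|x ^+ n - 1|.
  apply: lt_le_trans (lerB_normD _ _); rewrite normrN normr1 normrX.
  have : `|x| <= `|x| ^+ n by rewrite -(prednK Hn); apply: ler_eXnr.
  lra.
by rewrite normfV invf_plt // posrE ?(lt_trans _ H).
Qed.

Lemma qvar_neq0 : qvar != 0.
Proof. by rewrite tofrac_eq0F polyX_eq0. Qed.

Lemma lim_infty_inv_qvar : lim_infty qvar^-1 0.
Proof.
exists 1, 'X; split; rewrite ?polyX_eq0 ?rmorph1 ?div1r //.
move=> e e0; exists e^-1 => x Hx; rewrite hornerX hornerC div1r subr0 normfV invf_plt // posrE.
by apply: lt_trans Hx; rewrite invr_gt0.
Qed.

Lemma lim_inftyX f l n : lim_infty f l -> lim_infty (f ^+ n) (l ^+ n).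
Proof.
move=> H; elim: n => [|n IH]; first exact: (lim_infty_nat 1).
by rewrite !exprS; apply: lim_inftyM.
Qed.

Lemma lim_infty_exp_coef n : lim_infty (exp_coef Qq n) (exp_coef rat n).
Proof.
have -> : exp_coef Qq n = Qq_const (exp_coef rat n); last exact: lim_infty_const.
rewrite /exp_coef /Qq_const.
by rewrite -[RHS]/((@FracField.tofrac {poly rat} \o polyC) _) fmorphV rmorph_nat.
Qed.

(** * The limit of the equation for [Omega_q] *)

Lemma lim_infty_word_act (y : PLhat Qq) (a : PLhat rat) m w :
  (forall R, (treesize R <= m)%N -> lim_infty (y R) (a R)) ->
  forall S, (treesize S <= m + wdeg w)%N ->
  lim_infty (word_act y w S) (word_act a w S).
Proof.
elim: w m y a => [|T w IH] m y a H S; first by rewrite /wdeg big_nil addn0; apply: H.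
rewrite wdeg_cons addnA; apply: IH => R HR.
rewrite !(prelie_tree _ _ (leqnn _)); apply: lim_infty_sum => R' _.
case: (graft_count R' T R =P 0%N) => [->|/eqP /graft_count_neq0 E].
  by rewrite !mulr0; apply: (lim_infty_nat 0).
apply: lim_inftyM; last exact: lim_infty_nat.
by apply: H; move: HR; rewrite E leq_add2r.
Qed.

(** Grafting on another tree adds vertices, so only values of x on trees smaller than S occur. The
    value of the limit is irrelevant, as this term will be divided by q. *)
Lemma lim_infty_prelie_bullet (x : PLhat Qq) S :
  (forall T, (treesize T < treesize S)%N -> exists l, lim_infty (x T) l) ->
  exists l, lim_infty (prelie (bullet Qq) x S) l.
Proof.
move=> H; rewrite (prelieE _ _ (leqnn _)).
have /choice[l Hl] T : exists l, lim_infty (if (treesize T < treesize S)%N then x T else 0) l.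
  by case: ltnP => [/H //|_]; exists 0; apply: (lim_infty_nat 0).
exists (\sum_(T <- trees_le (treesize S)) \sum_(T' <- trees_le (treesize S))
   (T == dot)%:R * l T' * (graft_count T T' S)%:R).
apply: lim_infty_sum => T _; apply: lim_infty_sum => T' _.
case: (graft_count T T' S =P 0%N) => [->|/eqP /graft_count_neq0 E].
  by rewrite !mulr0; apply: (lim_infty_nat 0).
have := Hl T'; rewrite E -add1n leq_add2r treesize_gt0 => HT'.
by do 2?apply: lim_inftyM => //; apply: lim_infty_nat.
Qed.

Lemma word_actZ (K : fieldType) c (x : PLhat K) w S :
  word_act (c *: x) w S = c * word_act x w S.
Proof.
have := @word_act_lin K (treesize S) unit [:: tt] (fun=> c) (fun=> x) (c *: x) w.
by move=> /(_ _ S (leqnn _)) ->; rewrite ?big_seq1 // => T _; rewrite big_seq1.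
Qed.

Lemma Uact_expB1Z (K : fieldType) c (x om : PLhat K) S : Uact (c *: x) (Uexp om - 1) S =
  c * \sum_(w <- words_le (treesize S) | w != [::])
     exp_coef K (size w) * (\prod_(T <- w) om T) * word_act x w S.
Proof.
rewrite Uact_expB1 mulr_sumr; apply: eq_bigr => w _.
by rewrite word_actZ mulrCA.
Qed.

(** The equation at a tree T, with Q = q^#T, x the coefficient of [Omega_q] and q W the action term.
    Solving it gives the factor Q/(Q-1), written so that its limit 1 is visible. *)
Lemma Omegaq_solve (F : fieldType) (q Q x W D d : F) : q != 0 -> Q - 1 != 0 ->
  q * W + Q * x - x = D + (q - 1) * d ->
  q^-1 * (Q * x) = (1 + (Q - 1)^-1) * (q^-1 * D + (1 - q^-1) * d - W).
Proof.
move=> q0 Q0 E.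
have -> : D = q * W + Q * x - x - (q - 1) * d by rewrite E addrK.
by field; rewrite q0.
Qed.

Theorem proposition6p4 (Omega : PLhat rat) (Omega_q : PLhat Qq)
    (hOmega : is_Omega Omega) (hOmega_q : is_Omegaq Omega Omega_q) :
  coef_lim_infty (qvar^-1 *: dilate qvar Omega_q)
    (fun T : rtree => (-1) ^+ (treesize T).-1 / (aut T)%:R).
Proof.
rewrite -/Omega_infty; set y : PLhat Qq := _ *: _.
have yE : dilate qvar Omega_q = qvar *: y by rewrite scalerA divff ?qvar_neq0 ?scale1r.
have xE T : Omega_q T = qvar^-1 ^+ (treesize T).-1 * y T.
  rewrite -[y T]/(qvar^-1 * (qvar ^+ treesize T * Omega_q T)) mulrA -exprSr prednK ?treesize_gt0 //.
  by rewrite mulrA exprVn mulVf ?mul1r // expf_neq0 ?qvar_neq0.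
suff H n T : (treesize T <= n)%N -> lim_infty (y T) (Omega_infty T) by move=> T; apply: H.
elim: n T => [|n IH] T HT; first by have := treesize_gt0 T; rewrite ltnNge HT.
have HU := congr1 (fun z : PLhat rat => z T) (Uact_Omega_infty hOmega).
(* Isolating the empty word gives [Omega_infty T] in terms of smaller trees, in the shape that the
   formula for [y T] takes in the limit. *)
have {}HU : Omega_infty T = bullet rat T - Uact Omega_infty (Uexp Omega - 1) T.
  rewrite -HU /= /Uexp Useries_elt -[_ - 1]UprojB !Uact_proj tens_actB.
  by rewrite tens_act_word opprB addrC subrK.
rewrite HU Uact_expB1.
set k := treesize T; set D := prelie (bullet Qq) Omega_q T.
set W := \sum_(w <- words_le k | w != [::])
  exp_coef Qq (size w) * (\prod_(R <- w) (Qq_const \o Omega) R) * word_act y w T.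
have E : qvar * W + qvar ^+ k * Omega_q T - Omega_q T = D + (qvar - 1) * bullet Qq T.
  have <- : Uact (dilate qvar Omega_q) (Uexp (Qq_const \o Omega) - 1) T = qvar * W.
    by rewrite yE; exact: Uact_expB1Z.
  exact: (congr1 (fun z : PLhat Qq => z T) hOmega_q).
have [d Hd] : exists d, lim_infty D d.
  (* The limit of q^(1-#R) y_R; the convention 0^0 = 1 covers the one-vertex tree. *)
  apply: lim_infty_prelie_bullet => R HR; exists (0 ^+ (treesize R).-1 * Omega_infty R).
  rewrite xE; apply: lim_inftyM; last by apply: IH; rewrite -ltnS (leq_trans HR).
  exact/lim_inftyX/lim_infty_inv_qvar.
have k0 : (0 < k)%N := treesize_gt0 T.
have qk0 := qvarX_neq1 k0.
have -> : y T = (1 + (qvar ^+ k - 1)^-1) * (qvar^-1 * D + (1 - qvar^-1) * bullet Qq T - W).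
  exact: Omegaq_solve qvar_neq0 qk0 _.
set Wlim := (X in bullet rat T - X).
have -> : bullet rat T - Wlim = (1 + 0) * (0 * d + (1 - 0) * bullet rat T - Wlim) by ring.
apply: lim_inftyM.
  by apply: lim_inftyD; [exact: (lim_infty_nat 1) | exact: lim_infty_invX].
apply: lim_inftyB; last first.
  apply: lim_infty_sum => w Hw; apply: lim_inftyM.
    apply: lim_inftyM; first exact: lim_infty_exp_coef.
    by apply: lim_infty_prod => R _; apply: lim_infty_const.
  (* The word is nonempty, so its action at T only reads trees with at most n vertices. *)
  apply: (lim_infty_word_act IH); apply: leq_trans HT _; rewrite -addn1 leq_add2l.
  by case: w Hw => // R w _; rewrite wdeg_cons addn_gt0 treesize_gt0.
apply: lim_inftyD; first by apply: lim_inftyM => //; exact: lim_infty_inv_qvar.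
apply: lim_inftyM; last exact: lim_infty_nat.
by apply: lim_inftyB; [exact: (lim_infty_nat 1) | exact: lim_infty_inv_qvar].
Qed.
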